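(* Let $\Gamma$ be a countable group, $\Lambda$ a subgroup of $\Gamma$, and let $\alpha:\Gamma\to\Gamma/\Lambda$ be the canonical projection. For $\tau\in\mathrm{Prob}(\Gamma)$ write $\overline{\tau}=\alpha_*\tau$. (i) For all $\tau_1,\tau_2\in\mathrm{Prob}(\Gamma;\Lambda)$, $$\alpha_*(\tau_1*\tau_2)(\gamma\Lambda)=\sum_{\eta\Lambda\in\Gamma/\Lambda}\overline{\tau}_1(\eta\Lambda)\,\overline{\tau}_2(\eta^{-1}\gamma\Lambda)\quad\text{for every }\gamma\Lambda\in\Gamma/\Lambda .$$ In particular, $(\mathrm{Prob}(\Gamma;\Lambda),* )$ is a monoid with identity element $\delta_e$. (ii) If $\Gamma$ acts by linear isometries on a Banach space $E$ and the dual action preserves a weak*-closed convex subset $C$ of $E^*$, then $\mathrm{Prob}(\Gamma;\Lambda)*C^\Lambda\subseteq C^\Lambda$, where $C^\Lambda$ denotes the (possibly empty) set of $\Lambda$-invariant points in $C$. In particular, if $C$ is non-empty and weak*-compact and $\Lambda$ is amenable, then for every $\tau\in\mathrm{Prob}(\Gamma;\Lambda)$ there exists $c\in C^\Lambda$ such that $\tau*c=c$. (iii) If $(\Gamma,\Lambda)$ is a Hecke pair, then for every subset $S\subset\Gamma$ there exist a subset $\widetilde{S}\subset\Gamma$ and an affine map $\mathrm{Prob}(S)\to\mathrm{Prob}(\Gamma;\Lambda)\cap\mathrm{Prob}(\widetilde{S})$, $\tau\mapsto\widetilde{\tau}$, such that $\mathrm{supp}(\tau)\subseteq\mathrm{supp}(\widetilde{\tau})$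 for all $\tau \in \mathrm{Prob}(S)$. If $S$ is finite, then $\widetilde{S}$ can be chosen finite. In particular, if $\tau$ is spread-out, then so is $\widetilde{\tau}$.
   Context: $\mathrm{Prob}(\Gamma)$ and $\mathrm{Prob}(\Gamma/\Lambda)$ are the sets of probability measures on the countable sets $\Gamma$ and $\Gamma/\Lambda$; for $S\subset\Gamma$, $\mathrm{Prob}(S)$ is the set of $\tau\in\mathrm{Prob}(\Gamma)$ with $\tau(S)=1$. The push-forward is $\alpha_*\tau(\gamma\Lambda)=\sum_{\lambda\in\Lambda}\tau(\gamma\lambda)$. $\mathrm{Prob}(\Gamma/\Lambda)^\Lambda$ is the set of probability measures on $\Gamma/\Lambda$ invariant under left multiplication by $\Lambda$. The set of $\Lambda$-absorbing probability measures is $\mathrm{Prob}(\Gamma;\Lambda)=\{\tau\in\mathrm{Prob}(\Gamma):\alpha_*\tau\in\mathrm{Prob}(\Gamma/\Lambda)^\Lambda\}$. Convolution: $(\tau_1*\tau_2)(\gamma)=\sum_{\eta\in\Gamma}\tau_1(\eta)\tau_2(\eta^{-1}\gamma)$, and for $c\in E^*$, $\tau*c=\sum_{\gamma\in\Gamma}\tau(\gamma)\,\gamma c$, where $\gamma c$ denotes the dual action. $(\Gamma,\Lambda)$ is a Hecke pair if for every $\gamma\in\Gamma$ the subgroup $\Lambda\cap\gamma\Lambda\gamma^{-1}$ has finite index in $\Lambda$ (equivalently, every $\Lambda$-orbit in $\Gamma/\Lambda$ is finite). A probability measure on the countable discrete group $\Gamma$ is spread-out if its support generates $\Gamma$ as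 a semigroup. *)

(* Defs.v *)
From HB Require Import structures.
From mathcomp Require Import all_boot all_order all_algebra finmap.
From mathcomp Require Import generic_quotient complex.
From mathcomp Require Import all_classical all_reals all_analysis.
From mathcomp Require showcase.summability.

Set Implicit Arguments.
Unset Strict Implicit.
Unset Printing Implicit Defensive.

Import Order.TTheory GRing.Theory Num.Theory.
Import numFieldNormedType.Exports.

Local Open Scope quotient_scope.
Local Open Scope classical_set_scope.
Local Open Scope ring_scope.

(* In [groupClosed G] the carrier is a boolean predicate; classically this is
   the same thing as a subgroup of [G]. *)

Definition subgroup (G : groupType) (L : groupClosed G) : Type :=
  {x : G | x \in L}.

Section SubgroupGroup.
Variables (G : groupType) (L : groupClosed G).

HB.instance Definition _ := SubChoice.copy (subgroup L) {x : G | x \in L}.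

Fact subgroup_closed : group_closed (fun x : G => x \in L).
Proof. by split=> [|x y xL yL]; [exact: gpred1 | exact: gpredF]. Qed.

HB.instance Definition _ :=
  SubChoice_isSubGroup.Build G (fun x : G => x \in L) (subgroup L)
    subgroup_closed.

End SubgroupGroup.

Section Cosets.
Variables (G : groupType) (L : groupClosed G).

Definition lcoset_rel : rel G := fun x y => (x^-1 * y)%g \in L.

Fact lcoset_rel_refl : reflexive lcoset_rel.
Proof. by move=> x; rewrite /lcoset_rel mulVg gpred1. Qed.

Fact lcoset_rel_sym : symmetric lcoset_rel.
Proof. by move=> x y; rewrite /lcoset_rel -gpredV invgM invgK. Qed.

Fact lcoset_rel_trans : transitive lcoset_rel.
Proof.
move=> y x z; rewrite /lcoset_rel => xy yz.
have -> : (x^-1 * z = x^-1 * y * (y^-1 * z))%g by rewrite -mulgA mulVKg.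
exact: gpredM.
Qed.

Canonical lcoset_equiv :=
  EquivRel lcoset_rel lcoset_rel_refl lcoset_rel_sym lcoset_rel_trans.

Definition cosets : choiceType := {eq_quot lcoset_equiv}.

Definition coset_proj (g : G) : cosets := \pi_({eq_quot lcoset_equiv}) g.

Lemma coset_projP g h : coset_proj g = coset_proj h <-> (g^-1 * h)%g \in L.
Proof.
by rewrite /coset_proj; split=> [/eqquotP|gh]; [|apply/eqquotP].
Qed.

End Cosets.

(* A probability measure on a countable discrete set is identified with its
   mass function. *)
Section Prob.
Variables (R : realType) (T : choiceType).

Definition mass (p : T -> R) (S : set T) : \bar R := \esum_(x in S) (p x)%:E.

Definition Prob : set (T -> R) :=
  [set p | (forall x, 0 <= p x) /\ mass p setT = 1%E].

Definition ProbOn (S : set T) : set (T -> R) :=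
  [set p | Prob p /\ mass p S = 1%E].

Definition supp (p : T -> R) : set T := [set x | p x != 0].

Definition point_mass (x : T) : T -> R := fun y => (y == x)%:R.

Definition affine_on (A : set (T -> R)) (F : (T -> R) -> (T -> R)) :=
  forall p q (t : R), A p -> A q -> 0 <= t <= 1 ->
    F (fun x => t * p x + (1 - t) * q x) =
    (fun x => t * F p x + (1 - t) * F q x).

End Prob.

Arguments Prob R T : clear implicits.
Arguments ProbOn R {T} S.
Arguments point_mass R {T} x.

Definition is_monoid (T : Type) (M : set T) (op : T -> T -> T) (e : T) :=
  [/\ M e,
      forall x y, M x -> M y -> M (op x y),
      forall x y z, M x -> M y -> M z -> op x (op y z) = op (op x y) z,
      forall x, M x -> op e x = x &
      forall x, M x -> op x e = x].

Section GroupProb.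
Variables (R : realType) (G : groupType).
Implicit Types (p q : G -> R) (L : groupClosed G).

Definition convolution p q : G -> R :=
  fun g => fine (\esum_(h in [set: G]) (p h * q (h^-1 * g)%g)%:E).

Definition coset_push L p : cosets L -> R :=
  fun c => fine (mass p (@coset_proj G L @^-1` [set c])).

Lemma coset_pushE L p g : (forall x, 0 <= p x) ->
  coset_push p (coset_proj L g) = fine (\esum_(l in [set` L]) (p (g * l)%g)%:E).
Proof.
move=> p0; congr fine; rewrite /mass.
rewrite (reindex_esum [set` L] _ (fun l => g * l)%g) //.
split=> [l /= lL|x y _ _ /mulgI //|x /= /esym/coset_projP xL].
  by apply/esym/coset_projP; rewrite mulKg.
by exists (g^-1 * x)%g => //; rewrite mulVKg.
Qed.

Definition left_invariant L (m : cosets L -> R) :=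
  forall l g, l \in L -> m (coset_proj L (l * g)%g) = m (coset_proj L g).

Definition ProbInv L : set (cosets L -> R) :=
  [set m | Prob R (cosets L) m /\ left_invariant m].

Definition absorbing L : set (G -> R) :=
  [set p | Prob R G p /\ ProbInv (@coset_push L p)].

Definition mulg_stable (A : set G) := forall x y, A x -> A y -> A (x * y)%g.

Definition spread_out p := smallest mulg_stable (supp p) = [set: G].

End GroupProb.

Arguments absorbing R {G} L.

Definition finite_index (G : groupType) (H K : set G) :=
  finite_set [set [set (x * h)%g | h in H] | x in K].

Definition Hecke_pair (G : groupType) (L : groupClosed G) :=
  forall g : G,
    finite_index ([set` L] `&` [set (g * l * g^-1)%g | l in [set` L]]) [set` L].

(* Existence of a left-invariant mean on the bounded real functions on [H]. *)
Definition amenable (R : realType) (H : groupType) :=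
  exists m : (H -> R) -> R,
    [/\ forall (t : R) f g, bounded_fun (f : H -> R^o) ->
          bounded_fun (g : H -> R^o) ->
          m (fun x => t * f x + g x) = t * m f + m g,
        forall f, bounded_fun (f : H -> R^o) -> (forall x, 0 <= f x) -> 0 <= m f,
        m (fun=> 1) = 1 &
        forall (h : H) f, bounded_fun (f : H -> R^o) ->
          m (fun x => f (h * x)%g) = m f].

Section Dual.
Variables (K : numFieldType) (E : normedModType K).

Definition dual_pred : {pred E -> K^o} :=
  fun f => `[< linear f /\ continuous f >].

Fact dual_closed : submod_closed dual_pred.
Proof.
split=> [|a f g /asboolP[lf cf] /asboolP[lg cg]]; apply/asboolP; split.
- by move=> a x y /=; rewrite scaler0 addr0.
- exact: cst_continuous.
- move=> b x y; rewrite !fctE lf lg !scalerDr !scalerA [a * b]mulrC.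
  by rewrite addrACA.
- move=> x; apply: cvgD; last exact: cg.
  by apply: cvgZr; exact: cf.
Qed.

Definition dual : Type := {f : E -> K^o | f \in dual_pred}.

HB.instance Definition _ := SubChoice.copy dual {f : E -> K^o | f \in dual_pred}.

HB.instance Definition _ :=
  GRing.SubChoice_isSubLmodule.Build K (E -> K^o) (fun f => f \in dual_pred) dual
    (GRing.submod_closed_semi dual_closed).

Definition dual_fun (c : dual) : E -> K := val c.

(* Pointwise convergence on [E] is the weak* topology. *)
HB.instance Definition _ :=
  Topological.copy dual (initial_topology (dual_fun : dual -> {ptws E -> K^o})).

HB.instance Definition _ := isPointed.Build dual 0.

End Dual.

Coercion dual_fun : dual >-> Funclass.

Section Actions.
Variables (G : groupType) (K : numFieldType) (E : normedModType K).

Record isometric_action := IsometricAction {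
  iact :> G -> {linear E -> E};
  iact1 : forall x, iact 1%g x = x;
  iactM : forall g h x, iact (g * h)%g x = iact g (iact h x);
  iact_norm : forall g x, `|iact g x| = `|x|
}.

Variable a : isometric_action.

Fact dual_act_subproof g (c : dual E) :
  (fun x => c (a g^-1%g x)) \in @dual_pred K E.
Proof.
have /asboolP[lc cc] := valP c; apply/asboolP; split.
  by move=> t x y; rewrite linearP; exact: lc.
move=> x; apply: continuous_comp; last exact: cc.
apply/cvgrPdist_lt => e e0; near=> y.
rewrite -linearB iact_norm; near: y.
exact: cvgr_dist_lt.
Unshelve. all: by end_near. Qed.

Definition dual_act g (c : dual E) : dual E :=
  exist _ (fun x => c (a g^-1%g x)) (dual_act_subproof g c).

Definition dual_fixed (L : groupClosed G) (C : set (dual E)) : set (dual E) :=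
  [set c | C c /\ forall l, l \in L -> dual_act l c = c].

End Actions.

(* Banach spaces may be real or complex. *)
Variant scalar_kind := RealScalars | ComplexScalars.

Definition scalar_field (k : scalar_kind) (R : realType) : numFieldType :=
  match k with RealScalars => R | ComplexScalars => R[i] end.

Definition of_real (k : scalar_kind) (R : realType) : R -> scalar_field k R :=
  match k with RealScalars => id | ComplexScalars => real_complex R end.

(* The sum is the limit in [E^*], for the weak* topology, of the net of the sums
   over the finite subsets of [G]. *)
Definition dual_conv (k : scalar_kind) (R : realType) (G : groupType)
    (E : normedModType (scalar_field k R)) (a : isometric_action G E)
    (p : G -> R) (c : dual E) : dual E :=
  lim (summability.partial_sum (fun g => of_real k (p g) *: dual_act a g c)
       @ summability.totally).

(* Main.v *)
Require Import Defs.
From HB Require Import structures.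
From mathcomp Require Import all_boot all_order all_algebra finmap.
From mathcomp Require Import generic_quotient complex ring lra.
From mathcomp Require Import all_classical all_reals all_analysis.
From mathcomp Require showcase.summability.

(* (i) Fubini and the left invariance of [coset_push t2], which makes
   [h |-> coset_push t2 (h^-1 g L)] a function of the coset [h L].
   (iii) Replace each point mass at [g] by the uniform measure on a set of
   representatives, [g] among them, of the finite [L]-orbit of [g L].
   (ii) Convolution by [t] and averaging by an invariant mean on [L] are both
   of the form [c |-> (x |-> M (g |-> c (g^-1 x)))] for a mean [M] on bounded
   functions. A mean is approximated, on finitely many functions at once, by
   finite convex combinations of evaluations, so this barycentre stays in every
   closed convex set containing the orbit of [c], and no separation theorem is
   needed. A fixed point of the convolution is then a weak* limit of Cesaro
   means of an orbit in [dual_fixed a L C]. *)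

Set Implicit Arguments.
Unset Strict Implicit.
Unset Printing Implicit Defensive.

Import Order.TTheory GRing.Theory Num.Theory.
Import numFieldNormedType.Exports.

Local Open Scope classical_set_scope.
Local Open Scope ring_scope.

(** * Mixtures and push-forwards to the coset space *)

Section Esum.
Variable R : realType.

(** Sums are taken with [\esum] over nonnegative families, where exchange and reindexing need no
    summability condition; [fine] recovers real values once a bound is known, and signed functions
    are split into positive and negative parts. The delicate point is continuity of the convolution:
    it is obtained along filters containing a norm ball, where the tail of the measure is uniformly
    negligible. The Cesaro argument is therefore run in the intersection of the fixed set with such
    a ball, so barycentres must preserve the ball with the very same radius. Another gap to bridge
    is that [dual_conv] is a limit of finite sums while a mean is a functional on bounded functions:
    a mean is compared with the finite sums through its values on indicators of points, the error
    being governed by the missing mass. *)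

Lemma esum_swap (S T : choiceType) (A : set S) (B : set T)
    (f : S -> T -> \bar R) :
  (forall x y, A x -> B y -> (0 <= f x y)%E) ->
  (\esum_(x in A) \esum_(y in B) f x y = \esum_(y in B) \esum_(x in A) f x y)%E.
Proof.
move=> f0; rewrite esum_esum // [RHS]esum_esum; last first.
  by move=> y x By Ax; exact: f0.
rewrite (reindex_esum (B `*`` fun=> A) _ (fun z => (z.2, z.1))) //.
split; first by move=> [y x] [].
- by move=> [y x] [y' x'] _ _ [-> ->].
- by move=> [x y] [Ax By]; exists (y, x).
Qed.

(** Finite partial sums give the inequality [leZ] for every nonnegative factor; for [t > 0],
    applying it to [t^-1] gives the converse. *)
Lemma esumZl (T : choiceType) (A : set T) (t : R) (f : T -> \bar R) :
  0 <= t -> (forall x, (0 <= f x)%E) ->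
  (\esum_(x in A) (t%:E * f x) = t%:E * \esum_(x in A) f x)%E.
Proof.
have leZ (s : R) g : 0 <= s -> (forall x, (0 <= g x)%E) ->
    (\esum_(x in A) (s%:E * g x) <= s%:E * \esum_(x in A) g x)%E.
  move=> s0 g0; apply: ge_ereal_sup => _ [X [finX XA] <-].
  rewrite -ge0_mule_fsumr//.
  apply: lee_wpmul2l; first by rewrite lee_fin.
  by apply: ereal_sup_ubound; exists X.
rewrite le_eqVlt => /predU1P[<- _|t0 f0].
  by rewrite mul0e esum1// => x _; rewrite mul0e.
apply/eqP; rewrite eq_le; apply/andP; split; first by apply: leZ => //; exact: ltW.
rewrite -lee_pdivlMl//.
rewrite -[X in (X <= _)%E](@eq_esum _ _ _ (fun x => (t^-1)%:E * (t%:E * f x))%E).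
  apply: leZ => [|x]; first by rewrite invr_ge0 ltW.
  by apply: mule_ge0 => //; rewrite lee_fin ltW.
by move=> x _; rewrite muleA -EFinM mulVf ?gt_eqF// mul1e.
Qed.

(** Domination by [M] times the total mass. This is what justifies [fineK] wherever a real-valued
    definition hides an extended sum. *)
Lemma esum_fin (T : choiceType) (p f : T -> R) (M : R) (A : set T) :
  Prob R T p -> 0 <= M -> (forall x, 0 <= f x <= M) ->
  \esum_(x in A) (p x * f x)%:E \is a fin_num.
Proof.
move=> [p0 p1] M0 fM.
rewrite ge0_fin_numE; last first.
  by apply: esum_ge0 => x _; rewrite lee_fin mulr_ge0//; case/andP: (fM x).
apply: (@le_lt_trans _ _ M%:E); last exact: ltry.
rewrite -[leRHS]mule1 -p1 -esumZl//.
rewrite esum_mkcond; apply: le_esum => x _; case: ifP => _.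
  by rewrite -EFinM lee_fin mulrC ler_wpM2r//; case/andP: (fM x).
by rewrite -EFinM lee_fin mulr_ge0.
Qed.

Lemma Prob_le1 (T : choiceType) (p : T -> R) x : Prob R T p -> p x <= 1.
Proof.
move=> [p0 p1]; rewrite -lee_fin -p1 /mass (esumID [set x]).
  rewrite setTI esum_set1 ?lee_fin// leeDl//.
  by apply: esum_ge0 => y _; rewrite lee_fin.
by move=> y _; rewrite lee_fin.
Qed.

(** The image of [p] under a Markov kernel [k]. Convolution is the case of translates of a measure,
    the averaging over orbits that of [orbit_kernel]. *)
Definition mixture (S T : choiceType) (p : S -> R) (k : S -> T -> R) : T -> R :=
  fun y => fine (\esum_(x in [set: S]) (p x * k x y)%:E).

Section Mixture.
Variables (S T : choiceType) (p : S -> R) (k : S -> T -> R).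
Hypotheses (pP : Prob R S p) (kP : forall x, Prob R T (k x)).

Lemma mixtureE y :
  (mixture p k y)%:E = (\esum_(x in [set: S]) (p x * k x y)%:E)%E.
Proof.
rewrite fineK//; apply: (esum_fin (M := 1)) => // x.
by rewrite Prob_le1// andbT; case: (kP x).
Qed.

Lemma mixture_ge0 y : 0 <= mixture p k y.
Proof.
rewrite -lee_fin mixtureE//; apply: esum_ge0 => x _.
by rewrite lee_fin mulr_ge0//; [case: pP|case: (kP x)].
Qed.

Lemma mass_mixture A :
  mass (mixture p k) A = (\esum_(x in [set: S]) ((p x)%:E * mass (k x) A))%E.
Proof.
have [p0 _] := pP; have k0 x y : 0 <= k x y by case: (kP x).
rewrite /mass; under eq_esum do rewrite mixtureE//.
rewrite esum_swap; last by move=> *; rewrite lee_fin mulr_ge0.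
by apply: eq_esum => x _; rewrite -esumZl// => y; rewrite lee_fin.
Qed.

Lemma Prob_mixture : Prob R T (mixture p k).
Proof.
split; first exact: mixture_ge0.
rewrite mass_mixture; under eq_esum => x _ do rewrite (kP x).2 mule1.
by case: pP.
Qed.

End Mixture.

End Esum.

(** * Push-forwards to cosets, convolution and the monoid of absorbing measures *)

Section Coset.
Variables (R : realType) (G : groupType) (L : groupClosed G).
Implicit Types (p q : G -> R) (l g : G).
Local Open Scope ereal_scope.
Local Notation proj := (@coset_proj G L).

Local Notation push := (@coset_push R G L).

Definition crep (x : cosets L) : G := repr (x : {eq_quot lcoset_equiv L}%qT).

Lemma crepK : cancel crep proj.
Proof. by move=> x; exact: reprK. Qed.

Lemma crep_proj g : exists2 l, l \in L & crep (proj g) = (g * l)%g.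
Proof.
have /esym/coset_projP gL := crepK (proj g).
by exists (g^-1 * crep (proj g))%g => //; rewrite mulVKg.
Qed.

Definition coset_act g (x : cosets L) : cosets L := proj (g * crep x)%g.

Lemma coset_actE g h : coset_act g (proj h) = proj (g * h)%g.
Proof.
have [l lL e] := crep_proj h; rewrite /coset_act e mulgA.
by apply/esym/coset_projP; rewrite mulKg.
Qed.

Lemma coset_act_bij g : set_bij [set: cosets L] [set: cosets L] (coset_act g).
Proof.
have actK h : cancel (coset_act h) (coset_act h^-1%g).
  by move=> x; rewrite -(crepK x) !coset_actE mulKg.
split=> // [x y _ _ /(congr1 (coset_act g^-1%g))|x _]; first by rewrite !actK.
by exists (coset_act g^-1%g x) => //; rewrite -{1}(invgK g) actK.
Qed.

Lemma coset_push_fiber p x : Prob R G p ->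
  (push p x)%:E = \esum_(g in proj @^-1` [set x]) (p g)%:E.
Proof.
move=> pP; rewrite /coset_push /mass fineK//.
under eq_esum do rewrite -[p _]mulr1.
by apply: (esum_fin (M := 1%R)) => // y; rewrite ler01 lexx.
Qed.

Lemma coset_pushL p g : Prob R G p ->
  (push p (proj g))%:E = \esum_(l in [set` L]) (p (g * l)%g)%:E.
Proof.
move=> pP; have [p0 p1] := pP; rewrite coset_push_fiber//.
rewrite (reindex_esum [set` L] _ (fun l => g * l)%g) //.
split=> [l /= lL|x y _ _ /mulgI //|x /= /esym/coset_projP xL].
  by apply/esym/coset_projP; rewrite mulKg.
by exists (g^-1 * x)%g => //; rewrite mulVKg.
Qed.

Lemma coset_push_ge0 p x : Prob R G p -> (0 <= push p x)%R.
Proof.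
move=> pP; rewrite -lee_fin coset_push_fiber//.
by apply: esum_ge0 => g _; rewrite lee_fin; case: pP.
Qed.

Lemma esum_coset (u : G -> \bar R) : (forall g, 0 <= u g) ->
  \esum_(g in [set: G]) u g =
  \esum_(x in [set: cosets L]) \esum_(g in proj @^-1` [set x]) u g.
Proof.
move=> u0; rewrite esum_esum//.
rewrite (reindex_esum ([set: cosets L] `*`` (fun x => proj @^-1` [set x]))
  [set: G] snd)//; split=> //.
- by move=> [x g] [y h] /set_mem[_ /= <-] /set_mem[_ /= <-] ->.
- by move=> g _; exists (proj g, g).
Qed.

Lemma esum_coset_push p (v : cosets L -> R) : Prob R G p ->
  (forall x, 0 <= v x)%R ->
  \esum_(g in [set: G]) (p g * v (proj g))%:E =
  \esum_(x in [set: cosets L]) (push p x * v x)%:E.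
Proof.
move=> pP v0; have [p0 _] := pP.
rewrite esum_coset; last by move=> g; rewrite lee_fin mulr_ge0.
apply: eq_esum => x _; rewrite mulrC EFinM coset_push_fiber//.
rewrite -esumZl//.
by apply: eq_esum => g /= ->; rewrite mulrC.
Qed.

Lemma Prob_coset_push p : Prob R G p -> Prob R (cosets L) (push p).
Proof.
move=> pP; split; first by move=> x; exact: coset_push_ge0.
have := @esum_coset_push p (fun=> 1%R) pP (fun=> ler01).
under eq_esum do rewrite mulr1; under [RHS]eq_esum do rewrite mulr1.
by rewrite /mass => <-; case: pP.
Qed.

(* Absorption makes the integral of a right [L]-invariant function invariant
   under left translation by [L]. *)
Lemma absorbing_esum p (v : cosets L -> R) l : absorbing R L p -> l \in L ->
  (forall x, 0 <= v x)%R ->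
  \esum_(g in [set: G]) (p g * v (proj (l * g)%g))%:E =
  \esum_(g in [set: G]) (p g * v (proj g))%:E.
Proof.
move=> [pP [_ pinv]] lL v0.
under eq_esum do rewrite -coset_actE.
rewrite (@esum_coset_push p (fun x => v (coset_act l x)))// esum_coset_push//.
rewrite [RHS](reindex_esum _ _ _ _ (coset_act_bij l)).
apply: eq_esum => x _; congr ((_ * _)%:E).
by rewrite -(crepK x) coset_actE pinv.
Qed.

Lemma bij_mulg g : set_bij [set: G] [set: G] (fun h => g * h)%g.
Proof.
split=> // [x y _ _ /mulgI//|x _]; exists (g^-1 * x)%g => //.
by rewrite mulVKg.
Qed.

Lemma Prob_translate p g : Prob R G p -> Prob R G (fun h => p (g^-1 * h)%g).
Proof.
move=> [p0 p1]; split=> [h|]; first exact: p0.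
rewrite /mass (reindex_esum _ _ _ _ (bij_mulg g)) -p1.
by under eq_esum do rewrite mulKg.
Qed.

Lemma convolutionE p q g : Prob R G p -> Prob R G q ->
  (convolution p q g)%:E = \esum_(h in [set: G]) (p h * q (h^-1 * g)%g)%:E.
Proof.
move=> pP qP; apply: (mixtureE (k := fun h k => q (h^-1 * k)%g)) => // h.
exact: Prob_translate.
Qed.

Lemma Prob_convolution p q : Prob R G p -> Prob R G q ->
  Prob R G (convolution p q).
Proof.
move=> pP qP; apply: (Prob_mixture (k := fun h k => q (h^-1 * k)%g)) => // h.
exact: Prob_translate.
Qed.

Lemma push_mixture (S : choiceType) (p : S -> R) (k : S -> G -> R) x :
  Prob R S p -> (forall i, Prob R G (k i)) ->
  (push (mixture p k) x)%:E = \esum_(i in [set: S]) (p i * push (k i) x)%:E.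
Proof.
move=> pP kP; rewrite coset_push_fiber; last exact: Prob_mixture.
rewrite -/(mass _ _) mass_mixture//; apply: eq_esum => i _.
by rewrite EFinM (coset_push_fiber _ (kP i)).
Qed.

Lemma push_translate p h g : Prob R G p ->
  push (fun k => p (h^-1 * k)%g) (proj g) = push p (proj (h^-1 * g)%g).
Proof.
move=> pP; apply: EFin_inj; rewrite !coset_pushL//; last exact: Prob_translate.
by apply: eq_esum => l _; rewrite mulgA.
Qed.

Lemma push_convolution p q g : Prob R G p -> Prob R G q ->
  (push (convolution p q) (proj g))%:E =
  \esum_(h in [set: G]) (p h * push q (proj (h^-1 * g)%g))%:E.
Proof.
move=> pP qP; rewrite (push_mixture (k := fun h k => q (h^-1 * k)%g))//; last first.
  by move=> h; exact: Prob_translate.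
by apply: eq_esum => h _; rewrite push_translate.
Qed.

(** [h] and [rep (proj h)] differ by a right factor in [L]; inversion turns it into a left factor,
    which the invariance of [m] removes. *)
Lemma left_invariant_rep (m : cosets L -> R) rep h g : left_invariant m ->
  cancel rep proj ->
  m (proj (h^-1 * g)%g) = m (proj ((rep (proj h))^-1 * g)%g).
Proof.
move=> minv repK; have /coset_projP hL := repK (proj h).
by rewrite -(minv ((rep (proj h))^-1 * h)%g _ hL) -mulgA mulVKg.
Qed.

(** The arbitrary section [rep] expresses that the terms of the sum do not depend on the chosen
    representatives. *)
Lemma push_convolution_rep p q rep g : Prob R G p -> absorbing R L q ->
  cancel rep proj ->
  (push (convolution p q) (proj g))%:E =
  \esum_(x in [set: cosets L])
    (push p x * push q (proj ((rep x)^-1 * g)%g))%:E.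
Proof.
move=> pP [qP [_ qinv]] repK; rewrite push_convolution//.
under eq_esum => h _ do rewrite (left_invariant_rep h g qinv repK).
rewrite (@esum_coset_push p (fun x => push q (proj ((rep x)^-1 * g)%g)))//.
by move=> x; exact: coset_push_ge0.
Qed.

(** Since [h^-1 * l = (l^-1 * h)^-1], a left translation of the argument moves to the integration
    variable. Invariance of [push q] makes the integrand a function [v] of the coset of [h], and
    absorption by [p] then removes [l^-1]. *)
Lemma absorbing_convolution p q : absorbing R L p -> absorbing R L q ->
  absorbing R L (convolution p q).
Proof.
move=> pA qA; have [pP _] := pA; have [qP [_ qinv]] := qA.
split; first exact: Prob_convolution.
split; first exact/Prob_coset_push/Prob_convolution.
move=> l g lL; apply: EFin_inj; rewrite !push_convolution//.
pose v x := push q (proj ((crep x)^-1 * g)%g).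
transitivity (\esum_(h in [set: G]) (p h * v (proj (l^-1 * h)%g))%:E); last first.
  rewrite absorbing_esum ?gpredV//; last by move=> x; exact: coset_push_ge0.
  by apply: eq_esum => h _; rewrite (left_invariant_rep h g qinv crepK).
apply: eq_esum => h _; congr ((_ * _)%:E).
by rewrite /v -(left_invariant_rep _ g qinv crepK) invgM invgK mulgA.
Qed.

(** Both sides are the double sum of [p h * q (h^-1 * k) * r (k^-1 * g)], reached on the left by the
    substitution of [h * k] for the inner variable. *)
Lemma convolutionA p q r : Prob R G p -> Prob R G q -> Prob R G r ->
  convolution p (convolution q r) = convolution (convolution p q) r.
Proof.
move=> pP qP rP; have [p0 _] := pP; have [q0 _] := qP; have [r0 _] := rP.
have pqP := Prob_convolution pP qP; have qrP := Prob_convolution qP rP.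
apply/funext => g; apply: EFin_inj; rewrite !convolutionE//.
transitivity (\esum_(h in [set: G]) \esum_(k in [set: G])
    (p h * (q (h^-1 * k)%g * r (k^-1 * g)%g))%:E).
  apply: eq_esum => h _; rewrite EFinM convolutionE// -esumZl//; last first.
    by move=> k; rewrite lee_fin mulr_ge0.
  rewrite [RHS](reindex_esum _ _ _ _ (bij_mulg h)); apply: eq_esum => k _.
  by rewrite mulKg invgM mulgA EFinM.
rewrite esum_swap; last by move=> *; rewrite lee_fin !mulr_ge0.
apply: eq_esum => k _; rewrite mulrC EFinM convolutionE// -esumZl//.
  by apply: eq_esum => h _; rewrite -EFinM mulrA mulrC.
by move=> h; rewrite lee_fin mulr_ge0.
Qed.

Lemma esum_delta (T : choiceType) (x : T) (f : T -> R) : (forall y, 0 <= f y)%R ->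
  \esum_(y in [set: T]) (point_mass R x y * f y)%:E = (f x)%:E.
Proof.
move=> f0; rewrite (esumID [set x]); last first.
  by move=> y _; rewrite lee_fin mulr_ge0// ler0n.
rewrite setTI esum_set1; last by rewrite lee_fin mulr_ge0 ?ler0n.
rewrite esum1 ?adde0; first by rewrite /point_mass eqxx mul1r.
by move=> y [_ /= /eqP/negPf yx]; rewrite /point_mass yx mul0r.
Qed.

Lemma Prob_point_mass (x : G) : Prob R G (point_mass R x).
Proof.
split; first by move=> y; exact: ler0n.
rewrite /mass -[RHS](@esum_delta _ x (fun=> 1%R))//.
by under [RHS]eq_esum do rewrite mulr1.
Qed.

Lemma absorbing_unit : absorbing R L (point_mass R 1%g).
Proof.
have uP := Prob_point_mass 1%g.
split=> //; split; first exact: Prob_coset_push.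
(* The push-forward is the point mass at the coset of [1], which left multiplication by [L]
   fixes. *)
have pushE g : push (point_mass R 1%g) (proj g) = (g \in L)%:R%R.
  apply: EFin_inj; rewrite coset_push_fiber// esum_mkcond.
  transitivity (\esum_(h in [set: G])
      (point_mass R 1%g h * (proj h == proj g)%:R)%:E).
    apply: eq_esum => h _; case: ifPn => [/set_mem /= ->|].
      by rewrite eqxx mulr1.
    by rewrite notin_setE /= => /eqP/negPf ->; rewrite mulr0.
  rewrite (esum_delta _ (f := fun h => (proj h == proj g)%:R%R))//.
  congr ((nat_of_bool _)%:R%:E); apply/eqP/idP => [/coset_projP|gL].
    by rewrite invg1 mul1g.
  by apply/coset_projP; rewrite invg1 mul1g.
by move=> l g lL; rewrite !pushE gpredMl.
Qed.

Lemma conv1p p : Prob R G p -> convolution (point_mass R 1%g) p = p.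
Proof.
move=> pP; apply/funext => g; apply: EFin_inj.
rewrite convolutionE//; last exact: Prob_point_mass.
rewrite (@esum_delta _ 1%g (fun h => p (h^-1 * g)%g)) ?invg1 ?mul1g//.
by case: pP.
Qed.

Lemma convp1 p : Prob R G p -> convolution p (point_mass R 1%g) = p.
Proof.
move=> pP; apply/funext => g; apply: EFin_inj.
rewrite convolutionE//; last exact: Prob_point_mass.
rewrite -[RHS](@esum_delta _ g p); last by case: pP.
apply: eq_esum => h _; rewrite mulrC /point_mass; congr (((nat_of_bool _)%:R * _)%:E).
by rewrite -(inj_eq (mulgI h)) mulVKg mulg1.
Qed.

Lemma absorbing_monoid :
  is_monoid (absorbing R L) (@convolution R G) (point_mass R 1%g).
Proof.
split; first exact: absorbing_unit.
- by move=> p q; exact: absorbing_convolution.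
- by move=> p q r [pP _] [qP _] [rP _]; exact: convolutionA.
- by move=> p [pP _]; exact: conv1p.
- by move=> p [pP _]; exact: convp1.
Qed.

End Coset.

(** * Hecke pairs *)

Section Support.
Variables (R : realType) (T : choiceType).

Lemma ProbOn_supp (p : T -> R) S x : ProbOn R S p -> p x != 0 -> S x.
Proof.
move=> [[p0 p1] pS] px0; apply: contrapT => Sx.
(* A charged point outside [S] would add positive mass to the mass 1 already carried by [S]. *)
have : (1 < 1 :> \bar R)%E; last by rewrite ltxx.
rewrite -[X in (_ < X)%E]p1 /mass (esumID S); last by move=> y _; rewrite lee_fin.
rewrite setTI -/(mass p S) pS -[X in (X < _)%E]adde0 lteD2lE//.
rewrite setTI (esumID [set x]); last by move=> y _; rewrite lee_fin.
apply: (@lt_le_trans _ _ (p x)%:E); first by rewrite lte_fin lt_neqAle eq_sym px0 p0.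
rewrite (_ : _ `&` [set x] = [set x]).
  rewrite esum_set1 ?lee_fin// leeDl//; apply: esum_ge0 => y _.
  by rewrite lee_fin.
by apply/seteqP; split=> [y []//|y /= ->].
Qed.

Lemma affine_mixture (S : choiceType) (A : set (S -> R)) (k : S -> T -> R) :
  (A `<=` Prob R S) -> (forall x, Prob R T (k x)) ->
  forall p q (t : R), A p -> A q -> 0 <= t <= 1 ->
    mixture (fun x => t * p x + (1 - t) * q x) k =
    (fun y => t * mixture p k y + (1 - t) * mixture q k y).
Proof.
move=> AP kP p q t /AP pP /AP qP /andP[t0 t1]; apply/funext => y.
have [p0 _] := pP; have [q0 _] := qP; have k0 x z : 0 <= k x z by case: (kP x).
have s0 : 0 <= 1 - t by rewrite subr_ge0.
rewrite /mixture -[RHS]/(fine (_)%:E); congr fine.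
rewrite EFinD !EFinM !mixtureE// -!esumZl// -?esumD//;
  try by move=> *; rewrite ?mule_ge0 ?lee_fin ?mulr_ge0.
by apply: eq_esum => x _; rewrite mulrDl -!mulrA EFinD !EFinM.
Qed.

End Support.

Section Hecke.
Variables (R : realType) (G : groupType) (L : groupClosed G).
Hypothesis heckeL : Hecke_pair L.
Implicit Types (g y : G) (x : cosets L).
Local Notation proj := (@coset_proj G L).
Local Notation push := (@coset_push R G L).

Definition coset_orbit g : set (cosets L) :=
  [set proj (l * g)%g | l in [set` L]].

Lemma coset_orbit_refl g : coset_orbit g (proj g).
Proof. by exists 1%g; rewrite ?mul1g//=; exact: gpred1. Qed.

(** With [H] the intersection of [L] and its conjugate by [g], every [h] in [H] satisfies
    [h * g = g * l'] with [l'] in [L]. So the coset of [l * g] depends only on the class of [l]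
    modulo [H], and the orbit is an image of a finite set of classes. *)
Lemma finite_coset_orbit g : finite_set (coset_orbit g).
Proof.
have := heckeL g; rewrite /finite_index.
set H := _ `&` _ => /(finite_image (fun A => proj (xget 1%g A * g)%g)).
apply: sub_finite_set => _ [l lL <-].
exists [set (l * h)%g | h in H]; first by exists l.
(* [xget] returns some [l * h] of the class; the class is not empty because it contains [l]. *)
case: xgetP => [_ -> [h [_ [l' l'L <-]] <-]|/(_ l)[]].
  apply/coset_projP.
  rewrite -[(l * _ * g)%g]mulgA mulgVK [(l * (_ * _))%g]mulgA [((_ * l')^-1)%g]invgM mulgVK.
  by rewrite gpredV.
exists 1%g; rewrite ?mulg1//; split; first exact: gpred1.
by exists 1%g; rewrite /= ?mulg1 ?mulgV//; exact: gpred1.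
Qed.

(** A section of [proj] normalised to return [g] on its own coset, which puts [g] in the support of
    [orbit_kernel g]. The default of [xget] is never reached, [proj] being onto. *)
Definition coset_lift g x : G :=
  if x == proj g then g
  else xget g [set y | proj y = x].

Lemma coset_liftK g : cancel (coset_lift g) proj.
Proof.
move=> x; rewrite /coset_lift; case: eqP => [->//|_].
by case: xgetP => // /(_ (crep x))[]; exact: crepK.
Qed.

Lemma coset_lift_proj g : coset_lift g (proj g) = g.
Proof. by rewrite /coset_lift eqxx. Qed.

Definition orbit_lift g : set G := coset_lift g @` coset_orbit g.

Definition orbit_size g : R := #|` fset_set (coset_orbit g)|%:R.

Lemma orbit_size_gt0 g : 0 < orbit_size g.
Proof.
rewrite ltr0n cardfs_gt0; apply/fset0Pn; exists (proj g).
by rewrite in_fset_set ?inE; [exact: coset_orbit_refl|exact: finite_coset_orbit].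
Qed.

Definition orbit_kernel g y : R := (y \in orbit_lift g)%:R / orbit_size g.

Lemma orbit_kernelE g y :
  (orbit_kernel g y)%:E = if y \in orbit_lift g then (orbit_size g)^-1%:E else 0%E.
Proof. by rewrite /orbit_kernel; case: ifP; rewrite ?mul1r ?mul0r. Qed.

Lemma mass_orbit_kernel g A : orbit_lift g `<=` A ->
  mass (orbit_kernel g) A = 1%E.
Proof.
move=> gA; rewrite /mass; under eq_esum do rewrite orbit_kernelE.
(* The section is injective, so the sum has [orbit_size g] equal terms. *)
rewrite -esum_mkcondr setIC (setIidl gA) esum_image; last first.
  by move=> x y _ _; exact: (can_inj (coset_liftK g)).
have finO := finite_coset_orbit g.
rewrite esum_fset//; last by move=> *; rewrite lee_fin invr_ge0 ltW// orbit_size_gt0.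
rewrite fsbig_finite// sumEFin big_const_seq count_predT iter_addr addr0.
by rewrite -[_ *+ _]mulr_natr mulVf// gt_eqF// orbit_size_gt0.
Qed.

Lemma Prob_orbit_kernel g : Prob R G (orbit_kernel g).
Proof.
split; last exact: mass_orbit_kernel.
by move=> y; rewrite mulr_ge0 ?invr_ge0 ?ler0n// ltW// orbit_size_gt0.
Qed.

(** Exactly one chosen representative lies over each coset of the orbit. The push-forward is thus
    uniform on the orbit, and invariant whatever the representatives. *)
Lemma push_orbit_kernel g x :
  push (orbit_kernel g) x = (x \in coset_orbit g)%:R / orbit_size g.
Proof.
apply: EFin_inj; rewrite coset_push_fiber; last exact: Prob_orbit_kernel.
under eq_esum do rewrite orbit_kernelE.
rewrite -esum_mkcondr; case: (boolP (x \in coset_orbit g)) => [/set_mem xO|].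
  rewrite (_ : _ `&` _ = [set coset_lift g x]) ?esum_set1 ?mul1r//.
    by rewrite lee_fin invr_ge0 ltW// orbit_size_gt0.
  apply/seteqP; split=> [y [/= yx [z zO zy]]|_ /= ->].
    by rewrite -zy -yx -zy coset_liftK.
  by split; [exact: coset_liftK|exists x].
rewrite notin_setE => xO; rewrite mul0r (_ : _ `&` _ = set0) ?esum_set0//.
apply/seteqP; split=> // y [/= yx [z zO zy]].
by apply: xO; rewrite -yx -zy coset_liftK.
Qed.

Lemma coset_orbit_act g h l : l \in L ->
  (proj (l * h)%g \in coset_orbit g) = (proj h \in coset_orbit g).
Proof.
have sub k m : m \in L -> coset_orbit g (proj k) -> coset_orbit g (proj (m * k)%g).
  move=> mL [n nL /coset_projP nk]; exists (m * n)%g; first exact: gpredM.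
  by apply/coset_projP; rewrite -mulgA invgM -mulgA mulKg.
move=> lL; apply/idP/idP => /set_mem hO; apply/mem_set; last exact: sub.
by rewrite -(mulKg l h); apply: sub => //; rewrite gpredV.
Qed.

Lemma absorbing_mixture_orbit t : Prob R G t ->
  absorbing R L (mixture t orbit_kernel).
Proof.
move=> tP; have kP := Prob_orbit_kernel.
split; first exact: Prob_mixture.
split; first exact/Prob_coset_push/Prob_mixture.
move=> l g lL; apply: EFin_inj; rewrite !push_mixture//.
by apply: eq_esum => h _; rewrite !push_orbit_kernel coset_orbit_act.
Qed.

(** The single term of index [g] already contributes [t g / orbit_size g > 0]. *)
Lemma supp_mixture_orbit t : Prob R G t -> supp t `<=` supp (mixture t orbit_kernel).
Proof.
move=> tP g /= tg0; have kP := Prob_orbit_kernel; have [t0 _] := tP.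
have k0 h y : 0 <= orbit_kernel h y by case: (kP h).
rewrite /supp /= gt_eqF// -lte_fin mixtureE// (esumID [set g]); last first.
  by move=> h _; rewrite lee_fin mulr_ge0.
rewrite setTI esum_set1; last by rewrite lee_fin mulr_ge0.
apply: (@lt_le_trans _ _ (t g * orbit_kernel g g)%:E); last first.
  by rewrite leeDl//; apply: esum_ge0 => h _; rewrite lee_fin mulr_ge0.
rewrite lte_fin mulr_gt0//; first by rewrite lt_neqAle eq_sym tg0 t0.
rewrite /orbit_kernel mem_set ?mul1r ?invr_gt0 ?orbit_size_gt0//.
by exists (proj g); [exact: coset_orbit_refl|exact: coset_lift_proj].
Qed.

Lemma ProbOn_mixture_orbit S t : ProbOn R S t ->
  ProbOn R (\bigcup_(g in S) orbit_lift g) (mixture t orbit_kernel).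
Proof.
move=> tS; have [tP _] := tS; have kP := Prob_orbit_kernel.
split; first exact: Prob_mixture.
rewrite mass_mixture//; have [_ <-] := tP; apply: eq_esum => g _.
have [->|tg0] := eqVneq (t g) 0; first by rewrite mul0e.
rewrite mass_orbit_kernel ?mule1// => y gy; exists g => //.
exact: ProbOn_supp tg0.
Qed.

End Hecke.

Lemma Hecke_absorbing (R : realType) (G : groupType) (L : groupClosed G) :
  Hecke_pair L ->
  forall S : set G, exists (S' : set G) (F : (G -> R) -> (G -> R)),
     [/\ forall t, ProbOn R S t -> (absorbing R L `&` ProbOn R S') (F t),
         affine_on (ProbOn R S) F,
         forall t, ProbOn R S t -> supp t `<=` supp (F t),
         finite_set S -> finite_set S' &
         forall t, ProbOn R S t -> spread_out t -> spread_out (F t)].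
Proof.
move=> heckeL S; exists (\bigcup_(g in S) orbit_lift L g).
exists (fun t => mixture t (orbit_kernel R L)); split.
- move=> t tS; split; last exact: ProbOn_mixture_orbit.
  by apply: absorbing_mixture_orbit => //; case: tS.
- by apply: affine_mixture => [p []//|]; exact: Prob_orbit_kernel.
- by move=> t [tP _]; exact: supp_mixture_orbit.
- move=> finS; apply: bigcup_finite => // g _.
  exact/finite_image/finite_coset_orbit.
- move=> t [tP _]; rewrite /spread_out => spr; apply/seteqP; split=> // g _.
  have sg : [set: G] g by [].
  (* A multiplicatively stable set containing the larger support contains [supp t], hence
     everything. *)
  move: sg; rewrite -spr => sg A [mulA FA]; apply: sg; split=> //.
  by apply: subset_trans FA; exact: supp_mixture_orbit.
Qed.

(** * Means *)

Section Means.
Variables (R : realType) (T : choiceType).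
Implicit Types (f g : T -> R) (M : (T -> R) -> R).

(** A pointwise counterpart of the filter-based [bounded_fun] used in [amenable]; [amenable_fixed]
    passes from this form to that one. *)
Definition fbounded f := exists B : R, forall x, `|f x| <= B.

Lemma fbounded_cst (c : R) : fbounded (fun=> c).
Proof. by exists `|c|. Qed.

Lemma fbounded_lin (c : R) f g : fbounded f -> fbounded g ->
  fbounded (fun x => c * f x + g x).
Proof.
move=> [A fA] [B gB]; exists (`|c| * A + B) => x.
by rewrite (le_trans (ler_normD _ _))// lerD// normrM ler_wpM2l.
Qed.

Lemma fbounded_sum (J : Type) (s : seq J) (c : J -> R) (f : J -> T -> R) :
  (forall j, fbounded (f j)) -> fbounded (fun x => \sum_(j <- s) c j * f j x).
Proof.
move=> fB; elim: s => [|j s IHs].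
  by under eq_fun do rewrite big_nil; exact: fbounded_cst.
by under eq_fun do rewrite big_cons; exact: fbounded_lin.
Qed.

Lemma fbounded_indic (P : T -> bool) : fbounded (fun x => (P x)%:R).
Proof. by exists 1 => x; case: (P x); rewrite ?normr1 ?normr0. Qed.

Definition is_mean M :=
  [/\ forall c f g, fbounded f -> fbounded g ->
        M (fun x => c * f x + g x) = c * M f + M g,
      forall f, fbounded f -> (forall x, 0 <= f x) -> 0 <= M f &
      M (fun=> 1) = 1].

Variable M : (T -> R) -> R.
Hypothesis meanM : is_mean M.

Lemma meanP c f g : fbounded f -> fbounded g ->
  M (fun x => c * f x + g x) = c * M f + M g.
Proof. by case: meanM => + _ _; exact. Qed.

Lemma mean0 : M (fun=> 0) = 0.
Proof.
have := meanP 1 (fbounded_cst 0) (fbounded_cst 0).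
by rewrite mulr0 addr0 mul1r => /eqP; rewrite -subr_eq subrr => /eqP.
Qed.

Lemma meanZ c f : fbounded f -> M (fun x => c * f x) = c * M f.
Proof.
move=> fB; rewrite -[RHS]addr0 -mean0 -meanP//; last exact: fbounded_cst.
by congr M; apply/funext => x; rewrite addr0.
Qed.

Lemma mean_cst c : M (fun=> c) = c.
Proof.
have [_ _ M1] := meanM; have := meanZ c (fbounded_cst 1).
by rewrite M1 mulr1.
Qed.

Lemma meanB f g : fbounded f -> fbounded g -> M (fun x => f x - g x) = M f - M g.
Proof.
move=> fB gB; rewrite addrC -mulN1r -meanP//; congr M; apply/funext => x.
by rewrite mulN1r addrC.
Qed.

Lemma mean_le f g : fbounded f -> fbounded g -> (forall x, f x <= g x) -> M f <= M g.
Proof.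
move=> fB gB fg; rewrite -subr_ge0 -meanB//; have [_ M0 _] := meanM.
apply: M0 => [|x]; last by rewrite subr_ge0.
have := fbounded_lin (-1) fB gB.
by under eq_fun do rewrite mulN1r addrC.
Qed.

Lemma mean_norm_le f B : (forall x, `|f x| <= B) -> `|M f| <= B.
Proof.
move=> fB; have bf : fbounded f by exists B.
rewrite ler_norml -{1}(mean_cst (- B)) -{2}(mean_cst B).
apply/andP; split; apply: mean_le => //; try exact: fbounded_cst.
  by move=> x; have := fB x; rewrite ler_norml => /andP[].
by move=> x; have := fB x; rewrite ler_norml => /andP[].
Qed.

Lemma mean_sum (J : Type) (s : seq J) (c : J -> R) (f : J -> T -> R) :
  (forall j, fbounded (f j)) ->
  M (fun x => \sum_(j <- s) c j * f j x) = \sum_(j <- s) c j * M (f j).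
Proof.
move=> fB; elim: s => [|j s IHs].
  by under eq_fun do rewrite big_nil; rewrite big_nil mean0.
under eq_fun do rewrite big_cons.
by rewrite big_cons meanP ?IHs//; exact: fbounded_sum.
Qed.

(* Partition [T] into the finitely many cells on which every [F i] varies by
   at most [e] and sample one point per cell. *)
Lemma mean_approx (t0 : T) (I : finType) (F : I -> T -> R) (B e : R) :
  (forall i x, `|F i x| <= B) -> 0 < e ->
  exists (J : finType) (w : J -> R) (t : J -> T),
    [/\ forall j, 0 <= w j, \sum_j w j = 1 &
        forall i, `|M (F i) - \sum_j w j * F i (t j)| <= e].
Proof.
(* Shifted by [B], the values lie in [[0, 2 * B]] and fall into slices of width [e] numbered from 0
   to [N]; a cell is the vector [key x] of slice numbers. *)
move=> FB e0; pose N := Num.truncn (2 * B / e).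
pose cell i x := Num.truncn ((F i x + B) / e).
have cell_ge0 i x : 0 <= (F i x + B) / e.
  rewrite divr_ge0 ?(ltW e0)//; have := FB i x; rewrite ler_norml => /andP[]; lra.
have cellN i x : (cell i x < N.+1)%N.
  rewrite ltnS; apply: le_truncn; rewrite ler_pM2r ?invr_gt0//.
  by have := FB i x; rewrite ler_norml => /andP[]; lra.
pose key x := [ffun i => Ordinal (cellN i x)].
have keyP i x y : key x = key y -> `|F i x - F i y| <= e.
  move=> /ffunP/(_ i); rewrite !ffunE => /(congr1 val) /= xy.
  have := truncn_itv (cell_ge0 i x); have := truncn_itv (cell_ge0 i y).
  rewrite -/(cell i x) -/(cell i y) xy -natr1.
  rewrite !ler_pdivlMr// !ltr_pdivrMr// ler_norml => /andP[? ?] /andP[? ?].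
  apply/andP; split; lra.
(* The default [t0] serves the empty cells, whose weight is the mean of the zero function. *)
pose t j := xget t0 [set x | key x = j].
have tP x : key (t (key x)) = key x by rewrite /t; case: xgetP => // /(_ x)[].
exists {ffun I -> 'I_N.+1}, (fun j => M (fun x => (key x == j)%:R)), t; split.
- move=> j; case: meanM => _ M0 _; apply: M0 => [|x]; last exact: ler0n.
  exact: fbounded_indic.
- under eq_bigr do rewrite -[M _]mul1r.
  rewrite -mean_sum; last by move=> j; exact: fbounded_indic.
  rewrite -[RHS](mean_cst 1); congr M; apply/funext => x.
  rewrite (bigD1 (key x))//= eqxx mulr1 big1 ?addr0// => j /negPf.
  by rewrite eq_sym => ->; rewrite mulr0.
- move=> i; under eq_bigr do rewrite mulrC.
  have bF : fbounded (F i) by exists B.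
  rewrite -mean_sum => [|j]; last exact: fbounded_indic.
  rewrite -meanB//; last by apply: fbounded_sum => j; exact: fbounded_indic.
  apply: mean_norm_le => x.
  rewrite (bigD1 (key x))//= eqxx mulr1 big1 ?addr0.
    by apply: keyP; rewrite tP.
  by move=> j /negPf; rewrite eq_sym => ->; rewrite mulr0.
Qed.

End Means.

(** * Real and complex scalars treated uniformly *)

Section Scalars.
Variables (k : scalar_kind) (R : realType).
Local Notation K := (scalar_field k R).

Definition Kre : K -> R :=
  match k return scalar_field k R -> R with
  | RealScalars => id | ComplexScalars => @complex.Re R end.
Definition Kim : K -> R :=
  match k return scalar_field k R -> R with
  | RealScalars => fun=> 0 | ComplexScalars => @complex.Im R end.
(* For real scalars [Kim] is [0] and [Kmk] ignores its second argument. *)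
Definition Kmk : R -> R -> K :=
  match k return R -> R -> scalar_field k R with
  | RealScalars => fun x _ => x | ComplexScalars => @Complex R end.

End Scalars.

Section ScalarTheory.
Variables (R : realType).

Lemma KmkK k (z : scalar_field k R) : Kmk k (Kre z) (Kim z) = z.
Proof. by case: k z => //= -[]. Qed.

Lemma Kmk0 k (x : R) : Kmk k x 0 = of_real k x.
Proof. by case: k. Qed.

Lemma Kmk_lin k (z : scalar_field k R) (x y x' y' : R) :
  z * Kmk k x y + Kmk k x' y' =
  Kmk k (Kre z * x - Kim z * y + x') (Kre z * y + Kim z * x + y').
Proof.
case: k z => /= [z|[a b]]; first by rewrite mul0r subr0.
by [].
Qed.

Lemma Kre_lin k (z u v : scalar_field k R) :
  Kre (z * u + v) = Kre z * Kre u - Kim z * Kim u + Kre v.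
Proof.
case: k z u v => /= [z u v|[a b] [a' b'] [a'' b'']]; first by rewrite mul0r subr0.
by [].
Qed.

Lemma Kim_lin k (z u v : scalar_field k R) :
  Kim (z * u + v) = Kre z * Kim u + Kim z * Kre u + Kim v.
Proof.
case: k z u v => /= [z u v|[a b] [a' b'] [a'' b'']]; first by rewrite mul0r mulr0 !addr0.
by [].
Qed.

Lemma of_realD k (x y : R) : of_real k (x + y) = of_real k x + of_real k y.
Proof. by case: k => //=; rewrite rmorphD. Qed.

Lemma of_realM k (x y : R) : of_real k (x * y) = of_real k x * of_real k y.
Proof. by case: k => //=; rewrite rmorphM. Qed.

Lemma of_real0 k : of_real k (0 : R) = 0.
Proof. by case: k. Qed.

Lemma of_real1 k : of_real k (1 : R) = 1.
Proof. by case: k. Qed.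

Lemma of_real_le k (x y : R) : (of_real k x <= of_real k y) = (x <= y).
Proof. by case: k => //=; rewrite lecR. Qed.

Lemma of_real_lt k (x y : R) : (of_real k x < of_real k y) = (x < y).
Proof. by case: k => //=; rewrite ltcR. Qed.

Lemma of_real_norm k (x : R) : `|of_real k x| = of_real k `|x|.
Proof. by case: k => //=; rewrite normc_def /= expr0n /= addr0 sqrtr_sqr. Qed.

(** In the partial order of [R[i]] a nonnegative scalar is real; norms and tolerances in [K] can
    therefore be traded for real numbers. *)
Lemma of_real_ge0 k (z : scalar_field k R) : 0 <= z -> z = of_real k (Kre z).
Proof.
case: k z => [z|[a b]] /=; first by [].
by rewrite lecE /= => /andP[/eqP ->].
Qed.

Lemma Kre_gt0 k (z : scalar_field k R) : 0 < z -> 0 < Kre z.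
Proof. by move=> z0; rewrite -(of_real_lt k) of_real0 -of_real_ge0// ltW. Qed.

Lemma Kre_norm k (z : scalar_field k R) : of_real k `|Kre z| <= `|z|.
Proof. by case: k z => //= z; exact: normc_ge_Re. Qed.

Lemma Kim_norm k (z : scalar_field k R) : of_real k `|Kim z| <= `|z|.
Proof.
case: k z => [z|] /=; first by rewrite normr0.
(* Exchanging the coordinates keeps the modulus and turns the imaginary part into the real one. *)
move=> [a b]; have := normc_ge_Re (Complex b a).
by rewrite !normc_def /= addrC.
Qed.

(** A crude bound, the origin of the [e / 2] in [mean_ext_approx] and of the factor 2 in
    [mean_ext_atoms]. *)
Lemma Kmk_norm k (x y : R) : `|Kmk k x y| <= of_real k (`|x| + `|y|).
Proof.
case: k => /=; first by rewrite lerDl.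
rewrite normc_def /= lecR -[leRHS]ger0_norm ?addr_ge0// -sqrtr_sqr.
rewrite ler_sqrt ?sqr_ge0//.
rewrite sqrrD !real_normK ?num_real// addrAC lerDl mulrn_wge0// mulr_ge0//.
Qed.

End ScalarTheory.

(** * Extension of a mean to scalar-valued functions *)

Section MeanExt.
Variables (k : scalar_kind) (R : realType) (T : choiceType).
Local Notation K := (scalar_field k R).
Implicit Types (f g : T -> K) (B : R).

Lemma Kre_real (x : R) : Kre (of_real k x) = x.
Proof. by case: k. Qed.

Lemma Kim_real (x : R) : Kim (of_real k x) = 0.
Proof. by case: k. Qed.

Lemma KmkB (x y x' y' : R) :
  Kmk k x y - Kmk k x' y' = Kmk k (x - x') (y - y').
Proof. by case: k. Qed.

Lemma Kmk_sum (J : Type) (s : seq J) (w : J -> R) (u : J -> K) :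
  \sum_(j <- s) of_real k (w j) * u j =
  Kmk k (\sum_(j <- s) w j * Kre (u j)) (\sum_(j <- s) w j * Kim (u j)).
Proof.
elim: s => [|j s IHs]; first by rewrite !big_nil Kmk0 of_real0.
rewrite !big_cons IHs -{1}(KmkK (u j)) Kmk_lin Kre_real Kim_real !mul0r.
by rewrite subr0 addr0.
Qed.

Lemma of_real_eps (z : K) B :
  (forall e : R, 0 < e -> `|z| <= of_real k (B + e)) -> `|z| <= of_real k B.
Proof.
move=> zB; rewrite (of_real_ge0 (normr_ge0 z)) of_real_le.
apply/ler_addgt0Pr => e e0; have := zB e e0.
by rewrite {1}(of_real_ge0 (normr_ge0 z)) of_real_le.
Qed.

Lemma Kre_bound f B : (forall x, `|f x| <= of_real k B) ->
  forall x, `|Kre (f x)| <= B.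
Proof.
by move=> fB x; rewrite -(of_real_le k) (le_trans (Kre_norm _)).
Qed.

Lemma Kim_bound f B : (forall x, `|f x| <= of_real k B) ->
  forall x, `|Kim (f x)| <= B.
Proof.
by move=> fB x; rewrite -(of_real_le k) (le_trans (Kim_norm _)).
Qed.

Variable M : (T -> R) -> R.
Hypothesis meanM : is_mean M.

Definition mean_ext f : K :=
  Kmk k (M (fun x => Kre (f x))) (M (fun x => Kim (f x))).

Lemma mean_ext_lin (z : K) f g A B :
  (forall x, `|f x| <= of_real k A) -> (forall x, `|g x| <= of_real k B) ->
  mean_ext (fun x => z * f x + g x) = z * mean_ext f + mean_ext g.
Proof.
move=> fA gB; rewrite Kmk_lin; congr Kmk.
  under eq_fun do rewrite Kre_lin -addrA -mulNr.
  rewrite !meanP ?mulNr ?addrA//; try by exists A; exact: Kre_bound.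
  - by exists A; exact: Kim_bound.
  - by exists B; exact: Kre_bound.
  - by apply: fbounded_lin; [exists A; exact: Kim_bound|exists B; exact: Kre_bound].
under eq_fun do rewrite Kim_lin -addrA.
rewrite !meanP ?addrA//; try by exists A; exact: Kre_bound.
- by exists B; exact: Kim_bound.
- by exists A; exact: Kim_bound.
- by apply: fbounded_lin; [exists A; exact: Kre_bound|exists B; exact: Kim_bound].
Qed.

Lemma mean_ext_approx (t0 : T) (I : finType) (f : I -> T -> K) B (e : R) :
  (forall i x, `|f i x| <= of_real k B) -> 0 < e ->
  exists (J : finType) (w : J -> R) (t : J -> T),
    [/\ forall j, 0 <= w j, \sum_j w j = 1 &
        forall i, `|mean_ext (f i) - \sum_j of_real k (w j) * f i (t j)|
                  <= of_real k e].
Proof.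
(* Indexing by [I * bool] makes real and imaginary parts share the same weights and sample
   points. *)
move=> fB e0; pose F (ib : I * bool) x :=
  if ib.2 then Kre (f ib.1 x) else Kim (f ib.1 x).
have FB ib x : `|F ib x| <= B.
  by case: ib => i []; [exact: Kre_bound|exact: Kim_bound].
have e20 : 0 < e / 2 by rewrite divr_gt0.
have [J [w [t [w0 w1 wF]]]] := mean_approx meanM t0 FB e20.
exists J, w, t; split=> // i.
rewrite Kmk_sum KmkB (le_trans (Kmk_norm _ _ _))// of_real_le [leRHS]splitr.
by rewrite lerD//; [exact: (wF (i, true))|exact: (wF (i, false))].
Qed.

(** Separate bounds on real and imaginary parts would lose the constant. Approximation by convex
    combinations of values of [f] keeps [B] itself, as [dual_mean_ball] requires. *)
Lemma mean_ext_norm (t0 : T) f B :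
  (forall x, `|f x| <= of_real k B) -> `|mean_ext f| <= of_real k B.
Proof.
move=> fB; apply: of_real_eps => e e0.
have [J [w [t [w0 w1 wf]]]] := mean_ext_approx t0 (fun (_ : unit) => fB) e0.
rewrite -(subrK (\sum_j of_real k (w j) * f (t j)) (mean_ext f)).
rewrite (le_trans (ler_normD _ _))// addrC of_realD lerD//; last exact: wf.
rewrite (le_trans (ler_norm_sum _ _ _))// -[B]mul1r -w1 mulr_suml.
rewrite [X in _ <= X](big_morph _ (@of_realD R k) (@of_real0 R k)).
apply: ler_sum => j _; rewrite normrM of_real_norm (ger0_norm (w0 j)) of_realM.
by rewrite ler_wpM2l// -(of_real0 R k) of_real_le.
Qed.

Section Atoms.
Variable p : T -> R.
Hypothesis atomM : forall x, M (fun y => (y == x)%:R) = p x.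

(** The finite sum is the mean of [h] cut off outside [A]; the remainder is dominated by [B] times
    the indicator of the complement of [A], whose mean is the missing mass. *)
Lemma mean_atoms (h : T -> R) B (A : {fset T}) : (forall x, `|h x| <= B) ->
  `|M h - \sum_(x <- A) p x * h x| <= B * (1 - \sum_(x <- A) p x).
Proof.
move=> hB; have bh : fbounded h by exists B.
pose ind x (y : T) : R := (y == x)%:R.
have bi x : fbounded (ind x) by exact: fbounded_indic.
have -> : \sum_(x <- A) p x * h x = M (fun y => \sum_(x <- A) h x * ind x y).
  by rewrite mean_sum//; apply: eq_bigr => x _; rewrite atomM mulrC.
have -> : \sum_(x <- A) p x = M (fun y => \sum_(x <- A) 1 * ind x y).
  by rewrite mean_sum//; apply: eq_bigr => x _; rewrite atomM mul1r.
have bs c : fbounded (fun y => \sum_(x <- A) c x * ind x y) by exact: fbounded_sum.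
rewrite -{1}(mean_cst meanM 1) -!meanB//; try exact: fbounded_cst.
have bd : fbounded (fun y => 1 - \sum_(x <- A) 1 * ind x y).
  have := fbounded_lin (-1) (bs (fun=> 1)) (fbounded_cst _ 1).
  by under eq_fun do rewrite mulN1r addrC.
have bd' : fbounded (fun y => h y - \sum_(x <- A) h x * ind x y).
  have := fbounded_lin (-1) (bs h) bh.
  by under eq_fun do rewrite mulN1r addrC.
have key y : `|h y - \sum_(x <- A) h x * ind x y| <=
             B * (1 - \sum_(x <- A) 1 * ind x y).
  have sumE (c : T -> R) : \sum_(x <- A) c x * ind x y = if y \in A then c y else 0.
    case: ifPn => yA; last first.
      rewrite big_seq big1// => x xA; rewrite /ind.
      by case: eqP => [yx|_]; [rewrite yx xA in yA|rewrite mulr0].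
    rewrite (big_fsetD1 y)//= /ind eqxx mulr1 big_seq big1 ?addr0// => x.
    by rewrite !inE eq_sym => /andP[/negPf -> _]; rewrite mulr0.
  by rewrite !sumE; case: ifP => _; rewrite ?subrr ?normr0 ?mulr0// !subr0 mulr1.
rewrite -meanZ// ler_norml -[X in X <= _](opprK) opprK -mulN1r -meanZ//; last first.
  by have := fbounded_lin B bd (fbounded_cst _ 0); under eq_fun do rewrite addr0.
have bBd : fbounded (fun y => B * (1 - \sum_(x <- A) 1 * ind x y)).
  by have := fbounded_lin B bd (fbounded_cst _ 0); under eq_fun do rewrite addr0.
have bNd : fbounded (fun y => -1 * (B * (1 - \sum_(x <- A) 1 * ind x y))).
  by have := fbounded_lin (-1) bBd (fbounded_cst _ 0); under eq_fun do rewrite addr0.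
by apply/andP; split; apply: mean_le => // y; have := key y;
  rewrite ler_norml ?mulN1r => /andP[].
Qed.

Lemma mean_ext_atoms f B (A : {fset T}) : (forall x, `|f x| <= of_real k B) ->
  `|mean_ext f - \sum_(x <- A) of_real k (p x) * f x| <=
  of_real k (2 * B * (1 - \sum_(x <- A) p x)).
Proof.
move=> fB; rewrite Kmk_sum KmkB (le_trans (Kmk_norm _ _ _))// of_real_le.
set q := 1 - \sum_(x <- A) p x; have -> : 2 * B * q = B * q + B * q by ring.
by rewrite lerD//; apply: mean_atoms; [exact: Kre_bound|exact: Kim_bound].
Qed.

End Atoms.
End MeanExt.

(** * Integration against a probability measure, as a mean *)

Section ProbMean.
Variables (R : realType) (T : choiceType) (p : T -> R).
Hypothesis pP : Prob R T p.
Implicit Types (f u v : T -> R).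

End ProbMean.

Section ProbMean.
Variables (R : realType) (T : choiceType) (p : T -> R).
Hypothesis pP : Prob R T p.
Implicit Types (f u v : T -> R).

Let integ u : R := fine (\esum_(x in [set: T]) (p x * u x)%:E)%E.

Definition nng_bounded u := exists B : R, forall x, 0 <= u x <= B.

Let integE u : nng_bounded u ->
  ((integ u)%:E = \esum_(x in [set: T]) (p x * u x)%:E)%E.
Proof.
move=> [B uB]; rewrite /integ fineK//; apply: (esum_fin (M := `|B|)) => // x.
by have /andP[-> /= /le_trans->//] := uB x; rewrite ler_norm.
Qed.

Let ubndD u v : nng_bounded u -> nng_bounded v -> nng_bounded (fun x => u x + v x).
Proof.
move=> [A uA] [B vB]; exists (A + B) => x.
by have /andP[u0 u1] := uA x; have /andP[v0 v1] := vB x; rewrite addr_ge0//= lerD.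
Qed.

Let ubndZ (t : R) u : 0 <= t -> nng_bounded u -> nng_bounded (fun x => t * u x).
Proof.
move=> t0 [A uA]; exists (t * A) => x.
by have /andP[u0 u1] := uA x; rewrite mulr_ge0//= ler_wpM2l.
Qed.

Let ubnd_ge0 u x : nng_bounded u -> 0 <= u x.
Proof. by move=> [B uB]; case/andP: (uB x). Qed.

Let p_ge0 x : 0 <= p x. Proof. by case: pP. Qed.

Let integD u v : nng_bounded u -> nng_bounded v ->
  integ (fun x => u x + v x) = integ u + integ v.
Proof.
move=> ub vb; apply: EFin_inj; rewrite EFinD !integE//; last exact: ubndD.
rewrite -esumD; try by move=> *; rewrite lee_fin mulr_ge0// ubnd_ge0.
by apply: eq_esum => x _; rewrite -EFinD mulrDr.
Qed.

Let integZ t u : 0 <= t -> nng_bounded u ->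
  integ (fun x => t * u x) = t * integ u.
Proof.
move=> t0 ub; apply: EFin_inj; rewrite EFinM !integE//; last exact: ubndZ.
rewrite -esumZl//; last by move=> *; rewrite lee_fin mulr_ge0// ubnd_ge0.
by apply: eq_esum => x _; rewrite -EFinM mulrCA.
Qed.

Let integ_ge0 u : nng_bounded u -> 0 <= integ u.
Proof.
move=> ub; rewrite -lee_fin integE//; apply: esum_ge0 => x _.
by rewrite lee_fin mulr_ge0// ubnd_ge0.
Qed.

Definition pmean f : R :=
  integ (fun x => Num.max (f x) 0) - integ (fun x => Num.max (- f x) 0).

Let pos_ubnd f : fbounded f -> nng_bounded (fun x => Num.max (f x) 0).
Proof.
move=> [B fB]; exists B => x; have := fB x.
by rewrite ler_norml le_max lexx orbT /= => /andP[]; rewrite /Num.max; case: ltP; lra.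
Qed.

Let neg_ubnd f : fbounded f -> nng_bounded (fun x => Num.max (- f x) 0).
Proof.
move=> [B fB]; apply: (pos_ubnd (f := fun x => - f x)).
by exists B => x; rewrite normrN.
Qed.

(** With [f+] and [f-] the positive and negative parts, [f+ + v = f- + u], and all four are
    nonnegative. Any decomposition may thus replace the canonical one, whose parts are not additive
    in [f]. *)
Lemma pmeanE f u v : fbounded f -> nng_bounded u -> nng_bounded v ->
  (forall x, f x = u x - v x) -> pmean f = integ u - integ v.
Proof.
move=> fb ub vb fE; rewrite /pmean.
apply/eqP; rewrite subr_eq addrAC -subr_eq opprK; apply/eqP.
rewrite -!integD//; try exact: pos_ubnd; try exact: neg_ubnd.
congr fine; apply: eq_esum => x _; congr ((_ * _)%:E).
by rewrite fE /Num.max; case: ltP => ?; case: ltP => ?; lra.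
Qed.

Lemma is_mean_pmean : is_mean pmean.
Proof.
split=> [t f g fb gb|f [B fB] f0|].
- have [t0|/ltW t0] := leP 0 t.
    rewrite (@pmeanE _ (fun x => t * Num.max (f x) 0 + Num.max (g x) 0)
      (fun x => t * Num.max (- f x) 0 + Num.max (- g x) 0)).
    + rewrite !integD ?integZ//; try exact: pos_ubnd; try exact: neg_ubnd;
        try (apply: ubndZ => //; try exact: pos_ubnd; exact: neg_ubnd).
      rewrite /pmean; ring.
    + exact: fbounded_lin.
    + by apply: ubndD; [apply: ubndZ => //; exact: pos_ubnd|exact: pos_ubnd].
    + by apply: ubndD; [apply: ubndZ => //; exact: neg_ubnd|exact: neg_ubnd].
    + move=> x; rewrite opprD addrACA -mulrBr.
      have maxB (y : R) : Num.max y 0 - Num.max (- y) 0 = y.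
        by rewrite /Num.max; case: ltP => ?; case: ltP => ?; lra.
      by rewrite !maxB.
  (* A negative factor exchanges positive and negative parts. *)
  have t0' : 0 <= - t by rewrite oppr_ge0.
  rewrite (@pmeanE _ (fun x => - t * Num.max (- f x) 0 + Num.max (g x) 0)
    (fun x => - t * Num.max (f x) 0 + Num.max (- g x) 0)).
  + rewrite !integD ?integZ//; try exact: pos_ubnd; try exact: neg_ubnd;
      try (apply: ubndZ => //; try exact: pos_ubnd; exact: neg_ubnd).
    rewrite /pmean; ring.
  + exact: fbounded_lin.
  + by apply: ubndD; [apply: ubndZ => //; exact: neg_ubnd|exact: pos_ubnd].
  + by apply: ubndD; [apply: ubndZ => //; exact: pos_ubnd|exact: neg_ubnd].
  + move=> x; rewrite opprD addrACA -mulrBr.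
    have maxB (y : R) : Num.max y 0 - Num.max (- y) 0 = y.
      by rewrite /Num.max; case: ltP => ?; case: ltP => ?; lra.
    by rewrite maxB -[X in - t * X]opprB maxB mulrNN.
- have fu : nng_bounded f by exists B => x; rewrite f0 (le_trans (ler_norm _)).
  have zu : nng_bounded (fun=> 0) by exists 0 => x; rewrite lexx.
  rewrite (@pmeanE f f (fun=> 0))//; [|by exists B|by move=> x; rewrite subr0].
  rewrite subr_ge0 (_ : integ (fun=> 0) = 0) ?integ_ge0//.
  by rewrite /integ esum1// => x _; rewrite mulr0.
have zu : nng_bounded (fun=> 0) by exists 0 => x; rewrite lexx.
have ou : nng_bounded (fun=> 1) by exists 1 => x; rewrite lexx ler01.
rewrite (@pmeanE _ (fun=> 1) (fun=> 0))//; last 2 first.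
  exact: fbounded_cst.
  by move=> x; rewrite subr0.
rewrite {2}/integ esum1 ?subr0; last by move=> x _; rewrite mulr0.
apply: EFin_inj; rewrite integE//; case: pP => _ <-.
by rewrite /mass; under eq_esum do rewrite mulr1.
Qed.

Lemma pmean_atom x : pmean (fun y => (y == x)%:R) = p x.
Proof.
have zu : nng_bounded (fun=> 0) by exists 0 => y; rewrite lexx.
have iu : nng_bounded (fun y => (y == x)%:R).
  by exists 1 => y; case: eqP; rewrite lexx ler01.
rewrite (@pmeanE _ _ _ (fbounded_indic _ _) iu zu); last by move=> y; rewrite subr0.
rewrite {2}/integ esum1 ?subr0; last by move=> y _; rewrite mulr0.
apply: EFin_inj; rewrite integE// -[RHS](@esum_delta _ _ x p)//.
by apply: eq_esum => y _; rewrite mulrC.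
Qed.

Lemma Prob_tail (e : R) : 0 < e ->
  exists A0 : {fset T}, forall A : {fset T}, (A0 `<=` A)%fset ->
    1 - \sum_(x <- A) p x < e.
Proof.
move=> e0; have [_ p1] := pP.
have : ((1 - e)%:E < mass p setT)%E by rewrite p1 lte_fin ltrBlDr ltrDl.
move=> /ereal_sup_gt[_ [X [finX _] <-]]; rewrite fsbig_finite// sumEFin lte_fin.
move=> ltX; exists (fset_set X) => A XA.
rewrite ltrBlDl -ltrBlDr (lt_le_trans ltX)//.
rewrite [leRHS](bigID (mem (fset_set X)))/= -[leLHS]addr0 lerD ?sumr_ge0//.
rewrite -[leRHS]big_filter le_eqVlt; apply/orP; left; apply/eqP; apply: perm_big.
rewrite uniq_perm ?filter_uniq ?fset_uniq// => x.
rewrite mem_filter; case: (boolP (x \in fset_set X)) => //= xX.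
by rewrite (fsubsetP XA).
Qed.

End ProbMean.

(** Right invariance lets [f] be evaluated at [crep] of the coset, so its positive and negative
    parts come from nonnegative functions on cosets and [absorbing_esum] applies to each. *)
Lemma pmean_absorbing (R : realType) (G : groupType) (L : groupClosed G)
    (p : G -> R) (l : G) (f : G -> R) :
  absorbing R L p -> l \in L -> fbounded f ->
  (forall g m, m \in L -> f (g * m)%g = f g) ->
  pmean p (fun g => f (l * g)%g) = pmean p f.
Proof.
move=> pA lL fb finv; have fE g : f g = f (crep (coset_proj L g)).
  by have [m mL ->] := crep_proj L g; rewrite finv.
rewrite /pmean; congr (fine _ - fine _).
  under eq_esum => g _ do rewrite fE.
  under [RHS]eq_esum => g _ do rewrite fE.
  rewrite (absorbing_esum (v := fun x => Num.max (f (crep x)) 0) pA lL)//.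
  by move=> x; rewrite le_max lexx orbT.
under eq_esum => g _ do rewrite fE.
under [RHS]eq_esum => g _ do rewrite fE.
rewrite (absorbing_esum (v := fun x => Num.max (- f (crep x)) 0) pA lL)//.
by move=> x; rewrite le_max lexx orbT.
Qed.

(** * The weak* topology and barycentres *)

Section DualSpace.
Variables (K : numFieldType) (E : normedModType K).
Implicit Types (u v : dual E) (x y : E).

Lemma dual_ext u v : (forall x, u x = v x) -> u = v.
Proof. by move=> uv; apply/val_inj/funext. Qed.

Lemma dual_linear u (t : K) x y : u (t *: x + y) = t * u x + u y.
Proof. by have /asboolP[lu _] := valP u; exact: lu. Qed.

Lemma dual_applyD u v x : dual_fun (u + v) x = u x + v x.
Proof. by []. Qed.

Lemma dual_applyZ (z : K) u x : dual_fun (z *: u) x = z * u x.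
Proof. by []. Qed.

Lemma dual_applyB u v x : dual_fun (u - v) x = u x - v x.
Proof. by []. Qed.

Lemma dual_apply_sum (J : Type) (s : seq J) (P : pred J) (u : J -> dual E) x :
  dual_fun (\sum_(j <- s | P j) u j) x = \sum_(j <- s | P j) u j x.
Proof.
elim: s => [|j s IHs]; first by rewrite !big_nil.
by rewrite !big_cons; case: ifP => _; rewrite ?dual_applyD IHs.
Qed.

Lemma dual_bounded u : exists2 B : K, 0 < B & forall x, `|u x| <= B * `|x|.
Proof.
have /asboolP[lu cu] := valP u.
pose m := GRing.isLinear.Build _ _ _ _ (dual_fun u) lu.
pose lin : {linear E -> K^o} := HB.pack (dual_fun u) m.
exact: (@linear_lipschitz _ _ _ lin).
Qed.

Lemma mem_dual_pred (f : E -> K^o) (B : K) : 0 < B ->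
  (forall (t : K) x y, f (t *: x + y) = t * f x + f y) ->
  (forall x, `|f x| <= B * `|x|) -> f \in @dual_pred K E.
Proof.
move=> B0 lf fB; apply/asboolP; split=> [//|x].
apply/cvgrPdist_lt => e e0; near=> y.
have -> : f x - f y = f (x - y).
  by rewrite [x - y](_ : _ = -1 *: y + x) ?lf ?mulN1r 1?addrC// scaleN1r addrC.
rewrite (le_lt_trans (fB _))// mulrC -ltr_pdivlMr//; near: y.
by apply: cvgr_dist_lt => //; rewrite divr_gt0.
Unshelve. all: by end_near. Qed.

(** The weak* topology is initial for the inclusion into the pointwise topology: continuity of that
    inclusion gives one direction, and the preimages of open sets, which are the open sets of
    [dual E], give the other. *)
Lemma dual_cvgP (F : set_system (dual E)) (u : dual E) : Filter F ->
  F --> u <-> forall x, (fun v : dual E => (v x : K^o)) @ F --> (u x : K^o).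
Proof.
move=> FF; split=> [Fu x|Fu].
  have cont := @initial_continuous (dual E) {ptws E -> K^o} (@dual_fun K E) u.
  have /(@pointwise_cvgP E K^o _ (dual_fun u))/(_ x) :
      (@dual_fun K E : dual E -> {ptws E -> K^o}) @ F -->
      (dual_fun u : {ptws E -> K^o}).
    by apply: cvg_trans cont; exact: cvg_app.
  exact.
have /(@pointwise_cvgP E K^o _ (dual_fun u)) dFu : forall x,
    (fun g : {ptws E -> K^o} => g x) @
      ((@dual_fun K E : dual E -> {ptws E -> K^o}) @ F) --> (dual_fun u x : K^o).
  exact: Fu.
move=> A [_ [[B Bo <-] Bu BA]].
have : nbhs (dual_fun u : {ptws E -> K^o}) B by exact: open_nbhs_nbhs.
by move=> /dFu FB; exact: (filterS BA FB).
Qed.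

Lemma dual_hausdorff : hausdorff_space (dual E).
Proof.
move=> u v uv; apply: dual_ext => x.
apply: (@norm_hausdorff K K^o) => A B uA vB.
have evc (w : dual E) : (fun v : dual E => (v x : K^o)) @ w --> (w x : K^o).
  exact: ((dual_cvgP w (nbhs_filter w)).1 (@cvg_id _ _) x).
by have [w [Aw Bw]] := uv _ _ (evc u A uA) (evc v B vB); exists (dual_fun w x).
Qed.

(** [convex_set] speaks of two points, and the weights of a sublist do not add up to 1; hence the
    induction on normalised combinations in [H], where a tail of total weight zero is set apart. *)
Lemma convex_set_sum (C : set (dual E)) (J : eqType) (s : seq J) (w : J -> K)
    (u : J -> dual E) : convex_set C -> (forall j, C (u j)) ->
  (forall j, 0 <= w j) -> \sum_(j <- s) w j = 1 ->
  C (\sum_(j <- s) w j *: u j).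
Proof.
move=> cC Cu w0 s1.
have conv2 (t : K) a b : C a -> C b -> 0 <= t -> t <= 1 ->
    C (t *: a + (1 - t) *: b).
  move=> Ca Cb t0 t1.
  have := cC a b (Itv01 t0 t1) (mem_set Ca) (mem_set Cb).
  by move=> /set_mem.
suff H : forall s, 0 < \sum_(j <- s) w j ->
    C ((\sum_(j <- s) w j)^-1 *: \sum_(j <- s) w j *: u j).
  by have := H s; rewrite s1 invr1 scale1r; apply.
elim=> [|j s' IHs]; first by rewrite big_nil ltxx.
rewrite !big_cons => W0.
have : 0 <= \sum_(i <- s') w i by apply: sumr_ge0 => i _.
rewrite le_eqVlt => /predU1P[s0|sp].
  have wj0 : w j != 0 by move: W0; rewrite -s0 addr0 => /gt_eqF ->.
  have -> : \sum_(i <- s') w i *: u i = 0.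
    have : \sum_(i <- s') w i == 0 by rewrite -s0.
    rewrite psumr_eq0// => /allP w's0; rewrite big_seq big1// => i is'.
    by have /eqP -> := w's0 _ is'; rewrite scale0r.
  by rewrite -s0 !addr0 scalerA mulVf// scale1r.
set W := \sum_(i <- s') _ in sp W0 IHs *.
have := conv2 (w j / (w j + W)) _ _ (Cu j) (IHs sp).
have -> : 1 - w j / (w j + W) = W / (w j + W).
  by field; rewrite gt_eqF.
rewrite scalerDr !scalerA mulrAC mulfV ?gt_eqF// mul1r mulrC; apply.
  by rewrite mulrC divr_ge0// ltW.
by rewrite mulrC ler_pdivrMr// mul1r lerDl ltW.
Qed.

End DualSpace.

Section NormBall.
Variables (k : scalar_kind) (R : realType).
Local Notation K := (scalar_field k R).
Variable E : normedModType K.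
Implicit Types (u v : dual E) (x : E) (B : R).

Definition rnorm x : R := Kre `|x|.

Lemma rnormE x : `|x| = of_real k (rnorm x).
Proof. exact/of_real_ge0/normr_ge0. Qed.

Lemma rnorm_ge0 x : 0 <= rnorm x.
Proof. by rewrite -(of_real_le k) of_real0 -rnormE. Qed.

(** The ball of radius [B] for the dual norm, stated pointwise since the topology put on [dual E] is
    the weak* one. *)
Definition norm_ball B : set (dual E) :=
  [set u | forall x, `|u x| <= of_real k (B * rnorm x)].

Lemma dual_norm_ball u : exists2 B, 0 < B & norm_ball B u.
Proof.
have [B B0 uB] := dual_bounded u; exists (Kre B).
  by rewrite -(of_real_lt k) of_real0 -of_real_ge0// ltW.
by move=> x; rewrite of_realM -rnormE -of_real_ge0// ltW.
Qed.

End NormBall.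

(** * Barycentres of orbits with respect to a mean *)

Section DualMean.
Variables (k : scalar_kind) (R : realType) (G : groupType).
Local Notation K := (scalar_field k R).
Variables (E : normedModType K) (a : isometric_action G E).
Variables (T : choiceType) (t0 : T) (phi : T -> G).
Variable M : (T -> R) -> R.
Hypothesis meanM : is_mean M.
Implicit Types (u v : dual E) (x : E) (B : R).

Lemma orbit_bound B u x : norm_ball B u ->
  forall t, `|u (a (phi t)^-1%g x)| <= of_real k (B * rnorm x).
Proof. by move=> uB t; rewrite (le_trans (uB _))// /rnorm iact_norm. Qed.

Fact dual_mean_subproof u :
  (fun x => mean_ext M (fun t => u (a (phi t)^-1%g x))) \in @dual_pred K E.
Proof.
have [B B0 uB] := dual_norm_ball u.
apply: (@mem_dual_pred _ _ _ (of_real k B)) => [|z x y|x].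
- by rewrite -(of_real0 R k) of_real_lt.
- rewrite -(mean_ext_lin meanM z (orbit_bound x uB) (orbit_bound y uB)).
  by congr mean_ext; apply/funext => t; rewrite linearP dual_linear.
- rewrite rnormE -of_realM; apply: mean_ext_norm => //; exact: orbit_bound.
Qed.

(** The barycentre of the points [dual_act a (phi t) u]. Convolution is the case [phi = id] on [G],
    averaging over [L] the case [phi = val] on [subgroup L]. *)
Definition dual_mean u : dual E := 
  exist _ (fun x => mean_ext M (fun t => u (a (phi t)^-1%g x)))
    (dual_mean_subproof u).

Lemma dual_meanE u x :
  dual_mean u x = mean_ext M (fun t => u (a (phi t)^-1%g x)).
Proof. by []. Qed.

Lemma dual_mean_ball B u : norm_ball B u -> norm_ball B (dual_mean u).
Proof.
move=> uB x; rewrite dual_meanE; apply: mean_ext_norm => //.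
exact: orbit_bound.
Qed.

Lemma dual_mean_lin (z : K) u v :
  dual_mean (z *: u + v) = z *: dual_mean u + dual_mean v.
Proof.
have [A _ uA] := dual_norm_ball u; have [B _ vB] := dual_norm_ball v.
apply: dual_ext => x; rewrite dual_applyD dual_applyZ !dual_meanE.
by rewrite -(mean_ext_lin meanM z (orbit_bound x uA) (orbit_bound x vB)).
Qed.

#[local] Existing Instance summability.totally_filter.

Lemma dual_mean_in (C : set (dual E)) u : closed C -> convex_set C ->
  (forall t, C (dual_act a (phi t) u)) -> C (dual_mean u).
Proof.
move=> clC cvC Cu; have [B B0 uB] := dual_norm_ball u.
(* A convex combination of orbit points that is close to the barycentre on a finite set of vectors;
   such a set and a precision index the net converging to it. *)
have approx (An : {fset E} * nat) : exists v, C v /\ forall x, x \in An.1 ->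
    `|dual_mean u x - v x| <= of_real k (An.2.+1%:R^-1).
  case: An => A n /=.
  have [i x||J [w [t [w0 w1 wu]]]] := @mean_ext_approx k R T M meanM t0 A
      (fun i t => u (a (phi t)^-1%g (val i)))
      (* The sum over [A] bounds all the sampled functions at once. *)
      (B * \sum_(i : A) rnorm (val i)) (n.+1%:R^-1).
  - rewrite (le_trans (orbit_bound _ uB _))// of_real_le ler_wpM2l ?(ltW B0)//.
    rewrite (bigD1 i)//= lerDl sumr_ge0// => j _.
    by rewrite -(of_real_le k) of_real0 -rnormE.
  - by rewrite invr_gt0.
  exists (\sum_j of_real k (w j) *: dual_act a (phi (t j)) u); split.
    apply: convex_set_sum => //.
    - by move=> j; rewrite -(of_real0 R k) of_real_le.
    - by rewrite -(big_morph _ (@of_realD R k) (@of_real0 R k)) w1 of_real1.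
  move=> x xA; have := wu [` xA]%fset; rewrite dual_apply_sum.
  by [].
have [v vP] := choice approx.
apply: (@closed_cvg _ _ (filter_prod (@summability.totally E) \oo) _ v C clC).
  by apply: nearW => An; case: (vP An).
apply/dual_cvgP => x; apply/cvgrPdist_lt => e e0.
have e'0 := Kre_gt0 e0.
pose N := Num.truncn (Kre e)^-1.
exists ([set A : {fset E} | x \in A], [set n | (N <= n)%N]).
  split; last exact: nbhs_infty_ge.
  exists [fset x]%fset => // A; rewrite /= fsub1set; exact.
move=> [A n] [/= xA Nn].
have [_ /(_ x xA)/le_lt_trans] := vP (A, n); apply.
rewrite (of_real_ge0 (ltW e0)) of_real_lt /= invf_plt// ?posrE//.
have /andP[_] := truncn_itv (ltW (etrans (invr_gt0 _) e'0)).
by move=> /lt_le_trans; apply; rewrite ler_nat ltnS.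
Qed.

End DualMean.

(** * Convolution as a barycentre and its weak* continuity *)

Section Convolution.
Variables (k : scalar_kind) (R : realType) (G : groupType).
Local Notation K := (scalar_field k R).
Variables (E : normedModType K) (a : isometric_action G E).
Variable p : G -> R.
Hypothesis pP : Prob R G p.
Implicit Types (u v w : dual E) (x : E) (B : R).
Let meanM := is_mean_pmean pP.

Definition dual_pmean : dual E -> dual E := dual_mean a 1%g id meanM.

#[local] Existing Instance summability.totally_filter.

Lemma dual_pmean_atoms B u x (A : {fset G}) : norm_ball B u ->
  `|dual_pmean u x - \sum_(g <- A) of_real k (p g) * u (a g^-1%g x)| <=
  of_real k (2 * (B * rnorm x) * (1 - \sum_(g <- A) p g)).
Proof.
move=> uB; apply: mean_ext_atoms => //; first exact: pmean_atom.
exact: (@orbit_bound _ _ _ _ a _ id _ _ _ uB).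
Qed.

Lemma Prob_tailM (C : R) (e : K) : 0 <= C -> 0 < e ->
  exists A0 : {fset G}, forall A : {fset G}, (A0 `<=` A)%fset ->
    of_real k (C * (1 - \sum_(g <- A) p g)) < e.
Proof.
move=> C0 e0; have e'0 := Kre_gt0 e0.
(* [C] may vanish, so the tolerance is divided by [C + 1]. *)
have C1 : 0 < C + 1 by rewrite ltr_wpDl.
have [A0 A0P] := Prob_tail pP (divr_gt0 e'0 C1).
exists A0 => A /A0P; rewrite ltr_pdivlMr// => lt_e.
rewrite (of_real_ge0 (ltW e0)) of_real_lt.
have [q0|q0] := leP 0 (1 - \sum_(g <- A) p g).
  by rewrite (le_lt_trans _ lt_e)// mulrC ler_wpM2l// lerDl.
by rewrite (le_lt_trans _ e'0)// mulr_ge0_le0// ltW.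
Qed.

(** By [dual_pmean_atoms] the finite sums converge weak* to the barycentre, and limits are unique in
    a Hausdorff space. *)
Lemma dual_convE u : dual_conv a p u = dual_pmean u.
Proof.
apply: cvg_lim; first exact: dual_hausdorff.
have [B B0 uB] := dual_norm_ball u.
apply/dual_cvgP => x; apply/cvgrPdist_lt => e e0.
have rx0 := rnorm_ge0 x.
have C0 : 0 <= 2 * (B * rnorm x) by rewrite !mulr_ge0// ltW.
have [A0 A0P] := Prob_tailM C0 e0.
exists A0 => // A /= /A0P; apply: le_lt_trans.
rewrite /summability.partial_sum dual_apply_sum.
have := dual_pmean_atoms x A uB.
by rewrite [in X in X -> _]big_seq_fsetE.
Qed.

(** For one finite [A] the truncated sum is within [e / 3] uniformly on a norm ball, and a finite
    sum of evaluations is weak* continuous. *)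
Lemma dual_pmean_cvg (F : set_system (dual E)) B w x : ProperFilter F ->
  F (norm_ball B) -> F --> w ->
  (fun v => (dual_pmean v x : K^o)) @ F --> (dual_pmean w x : K^o).
Proof.
move=> FF FB /dual_cvgP Fw.
have [B1 B10 wB1] := dual_norm_ball w.
have rx0 := rnorm_ge0 x.
(* A common radius for the limit and for the elements of the filter; [B] has no prescribed sign. *)
pose B' := `|B| + B1.
have sub b v : b <= B' -> norm_ball b v -> norm_ball B' v.
  move=> bB vb y; rewrite (le_trans (vb y))// of_real_le ler_wpM2r//.
  exact: rnorm_ge0.
have wB : norm_ball B' w by apply: sub wB1; rewrite lerDr.
apply/cvgrPdist_lt => e e0; have e30 : 0 < e / 3 by rewrite divr_gt0.
have C0 : 0 <= 2 * (B' * rnorm x) by rewrite !mulr_ge0// addr_ge0// ltW.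
have [A AP] := Prob_tailM C0 e30; have {}AP := AP A (fsubset_refl A).
have : (fun v : dual E => \sum_(g <- A) of_real k (p g) * v (a g^-1%g x) : K^o) @ F
    --> (\sum_(g <- A) of_real k (p g) * w (a g^-1%g x) : K^o).
  apply: (@cvg_big K^o) => [|g _]; first exact: add_continuous.
  apply: cvgM; first exact: cvg_cst.
  exact: Fw.
move=> /cvgrPdist_lt/(_ _ e30) near_sum.
near=> v.
have vB : norm_ball B' v.
  apply: sub; last by near: v; exact: FB.
  by rewrite (le_trans (ler_norm _))// lerDl ltW.
set sw := \sum_(g <- A) of_real k (p g) * w (a g^-1%g x).
have : `|sw - \sum_(g <- A) of_real k (p g) * v (a g^-1%g x)| < e / 3.
  by near: v; exact: near_sum.
set sv := \sum_(g <- A) of_real k (p g) * v (a g^-1%g x) => svw.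
have wA : `|dual_pmean w x - sw| < e / 3 := le_lt_trans (dual_pmean_atoms x A wB) AP.
have vA : `|dual_pmean v x - sv| < e / 3 := le_lt_trans (dual_pmean_atoms x A vB) AP.
have -> : dual_pmean w x - dual_pmean v x =
    (dual_pmean w x - sw) + (sw - sv) - (dual_pmean v x - sv) by ring.
have -> : e = e / 3 + e / 3 + e / 3 by field.
rewrite (le_lt_trans (ler_normB _ _))// ltrD//.
by rewrite (le_lt_trans (ler_normD _ _))// ltrD.
Unshelve. all: by end_near. Qed.

End Convolution.

(** * Fixed points by Cesaro averaging *)

Section FixedPoint.
Variables (k : scalar_kind) (R : realType).
Local Notation K := (scalar_field k R).
Variables (E : normedModType K).
Implicit Types (u v w : dual E) (x : E).

(* Markov-Kakutani for a single map: ultrafilter limits of Cesaro means of an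
   orbit are fixed. *)
Lemma cesaro_fixed (C D : set (dual E)) (B : R) (T : dual E -> dual E) :
  compact C -> D `<=` C -> convex_set D -> D !=set0 -> D `<=` norm_ball B ->
  (forall (z : K) u v, T (z *: u + v) = z *: T u + T v) ->
  (forall u, D u -> D (T u)) ->
  (forall (F : set_system (dual E)) w x, ProperFilter F -> F D -> F --> w ->
     (fun v => (T v x : K^o)) @ F --> (T w x : K^o)) ->
  exists w (F : set_system (dual E)), [/\ ProperFilter F, F D, F --> w & T w = w].
Proof.
move=> compC DC cvD [u Du] DB Tlin TD Tcont.
have T0 : T 0 = 0.
  have := Tlin 1 0 0; rewrite !scale1r addr0 => /eqP.
  by rewrite -subr_eq subrr => /eqP.
have TZ z v : T (z *: v) = z *: T v.
  by rewrite -[z *: v]addr0 Tlin T0 addr0.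
have TD' v v' : T (v + v') = T v + T v' by have := Tlin 1 v v'; rewrite !scale1r.
have Du_ n : D (iter n T u) by elim: n => //= n; exact: TD.
pose c (n : nat) := n.+1%:R^-1 *: \sum_(i < n.+1) iter i T u : dual E.
have Dc n : D (c n).
  rewrite /c scaler_sumr; apply: convex_set_sum => //.
  by rewrite sumr_const card_ord -[LHS]mulr_natl mulfV// pnatr_eq0.
(* The sum telescopes to its two extreme iterates. *)
have Tc n : T (c n) - c n = n.+1%:R^-1 *: (iter n.+1 T u - u).
  rewrite /c TZ -scalerBr; congr (_ *: _).
  rewrite (big_morph T TD' T0) big_ord_recr [X in _ - X]big_ord_recl /=.
  rewrite opprD addrA addrAC; congr (_ - _).
  by rewrite addrAC subrr add0r.
have FD : (c @ \oo) D by exists 0%N => // n _; exact: Dc.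
have [U [UU cU]] := @ultraFilterLemma _ (c @ \oo) _.
have UD : U D := cU _ FD.
have [w Uw] : exists w : dual E, U --> w.
  move: compC; rewrite compact_ultra => /(_ U UU (filterS DC UD))[w [_ Uw]].
  by exists w.
(* [D] is not assumed closed: the limit comes from compactness of [C], and the filter is handed over
   so that the properties of [w] can be recovered from it. *)
exists w, U; split=> //; first exact: ultra_proper.
apply: dual_ext => x; apply/eqP; rewrite -subr_eq0 -normr_le0.
have rx0 := rnorm_ge0 x.
(* With [e] a sixth of a nonzero norm, that norm would be at most half of itself. The 3 counts the
   estimates [Ux], [UTx] and [UTD]. *)
suff small (e : K) : 0 < e -> `|T w x - w x| <= e * 3.
  rewrite real_leNgt ?normr_real// ?real0//; apply/negP => lt0.
  have := small (`|T w x - w x| / 6) (divr_gt0 lt0 _).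
  rewrite ltr0n => /(_ isT); set z := `|_| in lt0 *.
  have -> : z / 6 * 3 = z / 2 by field.
  by rewrite ler_pdivlMr// -[X in _ <= X]mulr1 ler_pM2l// (ler_nat _ 2 1).
move=> e0.
have e'0 := Kre_gt0 e0.
have Ux : U [set v : dual E | `|w x - v x| < e].
  by move/dual_cvgP : Uw => /(_ x)/cvgrPdist_lt/(_ _ e0).
have UTx : U [set v : dual E | `|T w x - T v x| < e].
  have Tw := Tcont U w x (@ultra_proper _ U UU) UD Uw.
  by move/cvgrPdist_lt : Tw => /(_ _ e0).
have UTD : U [set v : dual E | `|T v x - v x| < e].
  apply: cU; rewrite /fmap /=.
  (* Both extreme iterates lie in the ball, so at [x] the difference is at most [2 * (B * rnorm x)]
     divided by [n.+1]. *)
  pose N := Num.truncn (2 * (B * rnorm x) / Kre e).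
  exists N => // n /= Nn.
  rewrite -dual_applyB Tc dual_applyZ dual_applyB normrM ger0_norm ?invr_ge0//.
  rewrite mulrC ltr_pdivrMr// (le_lt_trans (ler_normB _ _))//.
  rewrite (le_lt_trans (lerD (DB _ (Du_ n.+1) x) (DB _ Du x)))//.
  rewrite -of_realD (of_real_ge0 (ltW e0)).
  have -> : n.+1%:R = of_real k n.+1%:R :> K.
    by elim: (n.+1) => [|m IHm]; rewrite ?of_real0// -!natr1 of_realD of_real1 IHm.
  rewrite -of_realM of_real_lt -ltr_pdivrMl// mulrC.
  have q0 : 0 <= 2 * (B * rnorm x) / Kre e.
    rewrite divr_ge0 ?(ltW e'0)// mulr_ge0// -(of_real_le k) of_real0.
    by rewrite (le_trans _ (DB _ Du x)).
  have /andP[_] := truncn_itv q0.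
  have -> : B * rnorm x + B * rnorm x = 2 * (B * rnorm x) by ring.
  by rewrite -/N => /lt_le_trans; apply; rewrite ler_nat ltnS.
have [v [[h1 h2] h3]] := filter_ex (filterI (filterI Ux UTx) UTD).
have -> : T w x - w x = (T w x - T v x) + (T v x - v x) - (w x - v x) by ring.
have -> : e * 3 = e + e + e by ring.
rewrite (le_trans (ler_normB _ _))// lerD ?ltW//.
by rewrite (le_lt_trans (ler_normD _ _))// ltrD.
Qed.

End FixedPoint.

(** * Invariant points of a closed convex set *)

Section InvariantPoints.
Variables (k : scalar_kind) (R : realType) (G : groupType) (L : groupClosed G).
Local Notation K := (scalar_field k R).
Variables (E : normedModType K) (a : isometric_action G E).
Variable C : set (dual E).
Hypotheses (clC : closed C) (cvC : convex_set C).
Hypothesis actC : forall g c, C c -> C (dual_act a g c).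
Implicit Types (u v w : dual E) (x : E).

(** Being fixed by [l] equates the evaluations at [x] and at [a l^-1 x], and both pass to the weak*
    limit. *)
Lemma dual_fixed_lim (F : set_system (dual E)) w : ProperFilter F ->
  F (dual_fixed a L C) -> F --> w -> dual_fixed a L C w.
Proof.
move=> FF FC Fw; split.
  by apply: (@closed_cvg _ _ F _ id C clC) => //; apply: filterS FC => v [].
move=> l lL; apply: dual_ext => x.
move/dual_cvgP : Fw => Fw.
have Fwl : (fun v : dual E => (v x : K^o)) @ F --> (w (a l^-1%g x) : K^o).
  apply: cvg_trans (Fw (a l^-1%g x)); apply: near_eq_cvg.
  apply: filterS FC => v [_ /(_ l lL) lv] /=.
  by rewrite -[in RHS]lv.
exact: (cvg_unique (@norm_hausdorff K K^o) Fwl (Fw x)).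
Qed.

(** Since [u] is fixed by [L], the function [g |-> u (a g^-1 x)] is right [L]-invariant. Acting by
    [l] on the barycentre replaces [g] by [l * g] in it, which absorption undoes. *)
Lemma dual_pmean_fixed (p : G -> R) (pA : absorbing R L p) u :
  dual_fixed a L C u -> dual_fixed a L C (dual_pmean a pA.1 u).
Proof.
move=> [Cu uL]; split.
  by apply: dual_mean_in => // g; exact: actC.
move=> l lL; apply: dual_ext => x.
have [B _ uB] := dual_norm_ball u.
have xB := @orbit_bound _ _ _ _ a _ id _ _ x uB.
have inv g m : m \in L -> u (a (g * m)^-1%g x) = u (a g^-1%g x).
  move=> mL; rewrite invgM iactM -[in RHS](uL m mL).
  by [].
transitivity (mean_ext (pmean p) (fun g => u (a (l * g)^-1%g x))).
  rewrite -[LHS]/(mean_ext (pmean p) (fun g => u (a g^-1%g (a l^-1%g x)))).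
  by congr mean_ext; apply/funext => g; rewrite invgM iactM.
congr Kmk.
- apply: (pmean_absorbing (f := fun g => Kre (u (a g^-1%g x))) pA lL).
    by exists (B * rnorm x); exact: Kre_bound.
  by move=> g m mL; rewrite inv.
- apply: (pmean_absorbing (f := fun g => Kim (u (a g^-1%g x))) pA lL).
    by exists (B * rnorm x); exact: Kim_bound.
  by move=> g m mL; rewrite inv.
Qed.

(** Acting by [l] on the barycentre of an [L]-orbit left-translates the averaged function, and the
    mean does not see it. *)
Lemma amenable_fixed : amenable R (subgroup L) -> C !=set0 ->
  dual_fixed a L C !=set0.
Proof.
move=> [m [mlin mpos m1 minv]] [u Cu].
have bndb (f : subgroup L -> R) : fbounded f -> bounded_fun (f : subgroup L -> R^o).
  move=> [B fB]; exists B; split; first exact: num_real.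
  by move=> A BA h _; exact: le_trans (fB h) (ltW BA).
have meanm : is_mean m.
  by split=> // [c f g /bndb fb /bndb gb|f /bndb fb]; [exact: mlin|exact: mpos].
exists (dual_mean a 1%g val meanm u); split.
  by apply: dual_mean_in => // h; exact: actC.
move=> l lL; apply: dual_ext => x.
have [B _ uB] := dual_norm_ball u.
have xB := @orbit_bound _ _ _ _ a (subgroup L) (fun h => val h) _ _ x uB.
pose l' : subgroup L := exist _ l lL.
transitivity (mean_ext m (fun h => u (a (val (l' * h)%g)^-1%g x))).
  rewrite -[LHS]/(mean_ext m (fun h : subgroup L =>
    u (a (val h)^-1%g (a l^-1%g x)))).
  by congr mean_ext; apply/funext => h; rewrite -iactM -invgM.
congr Kmk.
- apply: (minv l' (fun h => Kre (u (a (val h)^-1%g x)))); apply: bndb.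
  by exists (B * rnorm x); exact: Kre_bound.
- apply: (minv l' (fun h => Kim (u (a (val h)^-1%g x)))); apply: bndb.
  by exists (B * rnorm x); exact: Kim_bound.
Qed.

Lemma convex_fixed_ball B : convex_set (dual_fixed a L C `&` norm_ball B).
Proof.
move=> u v t /set_mem[[Cu uL] uB] /set_mem[[Cv vL] vB]; apply/mem_set.
have convE x : dual_fun (@conv K (convex_lmodType (dual E)) t u v) x =
    t%:num * dual_fun u x + (1 - t%:num) * dual_fun v x by [].
split; first split.
- by apply: set_mem; apply: cvC; exact: mem_set.
- move=> l lL; apply: dual_ext => x; rewrite convE.
  by rewrite -[in RHS](uL l lL) -[in RHS](vL l lL).
move=> x; rewrite convE (le_trans (ler_normD _ _))// !normrM.
have t0 : 0 <= t%:num :> K by [].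
have t1 : 0 <= 1 - t%:num :> K by rewrite subr_ge0.
rewrite (ger0_norm t0) (ger0_norm t1).
rewrite (le_trans (lerD (ler_wpM2l t0 (uB x)) (ler_wpM2l t1 (vB x))))//.
by rewrite -mulrDl addrC subrK mul1r.
Qed.

(** The ball is chosen around one fixed point [u] provided by amenability: the intersection is then
    nonempty, convex and stable, and bounded as [dual_pmean_cvg] demands. *)
Lemma dual_conv_fixed_point (p : G -> R) : compact C -> C !=set0 ->
  amenable R (subgroup L) -> absorbing R L p ->
  exists2 c : dual E, dual_fixed a L C c & dual_conv a p c = c.
Proof.
move=> compC C0 amL pA; have [u uL] := amenable_fixed amL C0.
have [B _ uB] := dual_norm_ball u.
have [||||z v v'|v|F w x FF FD Fw|w [F [FF FD Fw wE]]] := @cesaro_fixed k R E C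
    (dual_fixed a L C `&` norm_ball B) B (dual_pmean a pA.1) compC.
- by move=> v [[]].
- exact: convex_fixed_ball.
- by exists u.
- by move=> v [].
- exact: dual_mean_lin.
- by move=> [vL vB]; split; [exact: dual_pmean_fixed|exact: dual_mean_ball].
- have FB : F (norm_ball B) by apply: filterS FD => v []. 
  exact: (@dual_pmean_cvg _ _ _ _ a p pA.1 F B w x FF FB Fw). 
exists w; last by rewrite (dual_convE a pA.1).
by apply: (dual_fixed_lim FF _ Fw); apply: filterS FD => v [].
Qed.

End InvariantPoints.

Theorem theorem1p4 (R : realType) (G : groupType)
    (countG : countable [set: G]) (L : groupClosed G) :
  (* (i) *)
  ((forall t1 t2 : G -> R, absorbing R L t1 -> absorbing R L t2 ->
     forall rep : cosets L -> G, cancel rep (coset_proj L) -> forall g : G,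
       (coset_push (convolution t1 t2) (coset_proj L g))%:E =
       \esum_(x in [set: cosets L])
         (coset_push t1 x *
          coset_push t2 (coset_proj L ((rep x)^-1 * g)%g))%:E)
   /\
   is_monoid (absorbing R L) (@convolution R G) (point_mass R 1%g))
  /\
  (* (ii) *)
  (forall (k : scalar_kind) (E : completeNormedModType (scalar_field k R))
      (a : isometric_action G E) (C : set (dual E)),
    closed C -> convex_set C ->
    (forall (g : G) (c : dual E), C c -> C (dual_act a g c)) ->
    [set dual_conv a t c | t in absorbing R L & c in dual_fixed a L C]
      `<=` dual_fixed a L C
    /\
    (C !=set0 -> compact C -> amenable R (subgroup L) ->
     forall t : G -> R, absorbing R L t ->
       exists2 c : dual E, dual_fixed a L C c & dual_conv a t c = c))
  /\
  (* (iii) *)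
  (Hecke_pair L ->
   forall S : set G, exists (S' : set G) (F : (G -> R) -> (G -> R)),
     [/\ forall t, ProbOn R S t -> (absorbing R L `&` ProbOn R S') (F t),
         affine_on (ProbOn R S) F,
         forall t, ProbOn R S t -> supp t `<=` supp (F t),
         finite_set S -> finite_set S' &
         forall t, ProbOn R S t -> spread_out t -> spread_out (F t)]).
Proof.
split; [split|split].
- by move=> t1 t2 [t1P _] t2A rep repK g; exact: push_convolution_rep.
- exact: absorbing_monoid.
- move=> k E a C clC cvC actC; split=> [_ [t tA [c cC <-]]|C0 compC amL t tA].
    by rewrite (dual_convE a tA.1); exact: dual_pmean_fixed.
  exact: dual_conv_fixed_point.
- exact: Hecke_absorbing.
Qed.
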